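(* Let $\Psi:(0,\infty)\to(0,\infty)$ and $\omega:(0,\infty)\to(0,1)$ be such that $q\mapsto q^{2}\Psi(q)$ and $q\mapsto q^{2}\Psi(q)\omega(q)$ are non-increasing, $\sum_{q=1}^{\infty}q\Psi(q)<\infty$ and $\lim_{q\to\infty}\omega(q)=0$. Assume also that $$\omega(q)\geq\frac{45}{\Psi(q)}\Psi\left(\frac{1}{2q\Psi(q)}\right)$$ for all $q$ sufficiently large. Then $$\dim_H(E(\Psi,\omega))=\inf\left\{s\ge 0:\sum_{q=1}^{\infty}q(\Psi(q)\omega(q))^{s}<\infty\right\}.$$
   Context: $\dim_H$ denotes Hausdorff dimension. $W(\Psi)$ denotes the set of $x\in\mathbb{R}$ with $|x-p/q|\le\Psi(q)$ for infinitely many $(p,q)\in\mathbb{Z}\times\mathbb{N}$. $E(\Psi,\omega)$ denotes the set of $x\in W(\Psi)$ such that for all $q\in\mathbb{N}$ sufficiently large, $|x-p/q|\ge(1-\omega(q))\Psi(q)$ for all $p\in\mathbb{Z}$. *)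

(* Defs.v *)
From HB Require Import structures.
From mathcomp Require Import all_boot all_order all_algebra.
From mathcomp Require Import all_classical all_reals all_analysis.

Set Implicit Arguments.
Unset Strict Implicit.
Unset Printing Implicit Defensive.

Import Order.TTheory GRing.Theory Num.Theory.
Import numFieldNormedType.Exports.

Local Open Scope classical_set_scope.
Local Open Scope ring_scope.

Section HausdorffDimension.
Context {R : realType}.
Implicit Types (s d : R) (A U : set R).

(* The value at set0 is -oo, as the supremum of the empty set in \bar R;
   hence the separate case for set0 in hausdorff_gauge. *)
Definition diameter U : \bar R :=
  ereal_sup [set (`|xy.1 - xy.2|)%:E | xy in U `*` U].

(* |U|^s, with |set0|^s = 0 for every s, and |U|^0 = 1 for U nonempty
   (singletons included), so that s = 0 yields the counting measure. *)
Definition hausdorff_gauge s U : \bar R :=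
  if pselect (U = set0) then 0%E else poweR (diameter U) s.

(* Finite covers are included, since the F i may be empty. *)
Definition delta_cover d A (F : (set R)^nat) : Prop :=
  A `<=` \bigcup_i F i /\ forall i, (diameter (F i) <= d%:E)%E.

Definition hausdorff_premeasure s d A : \bar R :=
  ereal_inf [set (\sum_(0 <= i <oo) hausdorff_gauge s (F i))%E
            | F in delta_cover d A].

(* The supremum over d > 0 is the limit as d tends to 0. *)
Definition hausdorff_measure s A : \bar R :=
  ereal_sup [set hausdorff_premeasure s d A | d in [set d | 0 < d]].

Definition hausdorff_dim A : \bar R :=
  ereal_inf [set s%:E | s in [set s | 0 <= s /\ hausdorff_measure s A = 0%E]].

End HausdorffDimension.

Section Approximation.
Context {R : realType}.
Implicit Types (Psi omega : R -> R).

Definition W Psi : set R :=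
  [set x | infinite_set [set pq : int * nat | (0 < pq.2)%N /\
             `|x - pq.1%:~R / pq.2%:R| <= Psi pq.2%:R]].

Definition E Psi omega : set R :=
  [set x | W Psi x /\ \forall q \near \oo, forall p : int,
             `|x - p%:~R / q%:R| >= (1 - omega q%:R) * Psi q%:R].

End Approximation.

(* Main.v *)
Require Import Defs.
From HB Require Import structures.
From mathcomp Require Import all_boot all_order all_algebra.
From mathcomp Require Import all_classical all_reals all_analysis.
From mathcomp Require Import measurable_realfun ring lra zify.

Set Implicit Arguments.
Unset Strict Implicit.
Unset Printing Implicit Defensive.

Import Order.TTheory GRing.Theory Num.Theory.
Import numFieldNormedType.Exports.

Local Open Scope classical_set_scope.
Local Open Scope ring_scope.

(** Upper bound: [E Psi omega] lies in the limsup of the annuli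
    [(1 - omega q) Psi q <= |x - p/q| <= Psi q], each of which is covered by two
    intervals of length [omega q * Psi q].

    Lower bound: let [s] be below the critical exponent and let balls
    [B(c i, w i)] have small total [w i ^ s]. Nested intervals avoiding more and
    more balls are built, no mass distribution being needed. Given such an
    interval [J] and [Q = 2^n] with [Q^2 (omega Q * Psi Q)^s] huge, the points of
    [J] too close to a rational of small denominator, or charged too much by the
    balls, have total length less than half of [J]. A remaining point [x] has a
    Dirichlet approximation [p/q] with [q] comparable to [Q], and the next
    interval is a third of [[p/q + (1 - omega q) Psi q, p/q + Psi q]]. Rationals
    [r/t] with [t <= 1/(2 q Psi q)] are kept away by their distance to [p/q]; for
    larger [t] the hypothesis on [omega] makes [Psi t] at most
    [omega q * Psi q / 45], and one of the two outer thirds misses all of them. *)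

(** * Separation of rationals and Dirichlet approximation *)

Lemma rat_dist_ge (R : realType) (r r' : int) (t t' : nat) :
  (0 < t)%N -> (0 < t')%N -> r%:~R / t%:R != r'%:~R / t'%:R :> R ->
  (t%:R * t'%:R)^-1 <= `|r%:~R / t%:R - r'%:~R / t'%:R| :> R.
Proof.
move=> t0 t'0 neq.
have tR : (0 : R) < t%:R by rewrite ltr0n.
have tR' : (0 : R) < t'%:R by rewrite ltr0n.
have tt : (0 : R) < t%:R * t'%:R by rewrite mulr_gt0.
have E : r%:~R / t%:R - r'%:~R / t'%:R =
    (r * t'%:Z - r' * t%:Z)%:~R / (t%:R * t'%:R) :> R.
  by rewrite rmorphB !rmorphM /= -!pmulrn; field; rewrite !gt_eqF.
rewrite E normrM normfV (gtr0_norm tt) ler_pdivlMr // mulVf ?gt_eqF //.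
rewrite -intr_norm -[1]/(1%:~R) ler_int -gtz0_ge1 normr_gt0.
by apply: contraNneq neq => e0; rewrite -subr_eq0 E e0 mul0r.
Qed.

(* One rational at most in each half-open cell of length T^-2. *)
Lemma rat_cells (R : realType) (T : nat) (al ell : R) :
  (0 < T)%N -> 0 <= ell -> exists s : seq R,
    (size s)%:R <= T%:R ^+ 2 * ell + 1 /\
    forall (r : int) (t : nat), (0 < t)%N -> (t < T)%N ->
      al <= r%:~R / t%:R <= al + ell -> r%:~R / t%:R \in s.
Proof.
move=> T0 ell0; have TR : (0 : R) < T%:R by rewrite ltr0n.
pose P k (z : R) := exists (r : int) (t : nat),
  [/\ (0 < t)%N, (t < T)%N, z = r%:~R / t%:R, al <= z &
      Num.trunc (T%:R ^+ 2 * (z - al)) = k].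
(* A cell without such a rational contributes the dummy value [al], which the size bound already
   counts. *)
pose z k := xget al (P k).
exists [seq z k | k <- iota 0 (Num.trunc (T%:R ^+ 2 * ell)).+1]; split.
  rewrite size_map size_iota -addn1 natrD lerD2r truncn_le.
  by rewrite mulr_ge0 ?exprn_ge0 // ltW.
move=> r t t0 tT /andP[l u]; apply/mapP; set y := r%:~R / t%:R in l u *.
pose k := Num.trunc (T%:R ^+ 2 * (y - al)).
have Pk : P k y by exists r, t.
exists k.
  rewrite mem_iota add0n /= ltnS le_truncn //.
  by rewrite ler_wpM2l ?exprn_ge0 ?(ltW TR)// lerBlDl.
have [r' [t' [t'0 t'T zE alz kE]]] : P k (z k) by exact: (xgetPex _ (ex_intro _ y Pk)).
apply/eqP; apply: contraT => neq.
have := @rat_dist_ge R r r' t t' t0 t'0.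
rewrite -zE -/y => /(_ neq); rewrite leNgt => /negP[].
have tt : (t%:R * t'%:R : R) <= T%:R ^+ 2.
  by rewrite expr2 ler_pM // ler_nat ltnW.
have T2 : (0 : R) < T%:R ^+ 2 by rewrite exprn_gt0.
apply: (@lt_le_trans _ _ (T%:R ^+ 2)^-1); last first.
  by rewrite lef_pV2 // posrE mulr_gt0 // ltr0n.
have y0 : 0 <= T%:R ^+ 2 * (y - al) by rewrite mulr_ge0 ?subr_ge0 // ltW.
have z0 : 0 <= T%:R ^+ 2 * (z k - al) by rewrite mulr_ge0 ?subr_ge0 // ltW.
have /andP[a1 b1] := truncn_itv y0; have /andP[a2 b2] := truncn_itv z0.
rewrite kE in a2 b2; rewrite -/k in a1 b1.
rewrite -(ltr_pM2l T2) mulfV ?gt_eqF // -{1}(gtr0_norm T2) -normrM ltr_norml.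
move: a1 b1 a2 b2; rewrite -!natr1 => a1 b1 a2 b2.
by apply/andP; split; lra.
Qed.

(** Pigeonhole: the [Q + 1] fractional parts of [k * x], [0 <= k <= Q], fall into [Q] boxes of
    length [1 / Q]. Two multiples in one box are subtracted, and the difference of their indices is
    the denominator. *)
Lemma dirichlet (R : realType) (x : R) (Q : nat) : (0 < Q)%N ->
  exists (p : int) (q : nat), [/\ (0 < q)%N, (q <= Q)%N &
    `|x - p%:~R / q%:R| <= (q%:R * Q%:R)^-1].
Proof.
case: Q => // Q' _; set Q := Q'.+1.
have QR : (0 : R) < Q%:R by rewrite ltr0n.
pose fr (k : nat) : R := k%:R * x - (Num.floor (k%:R * x))%:~R.
have fr0 k : 0 <= fr k by rewrite subr_ge0 floor_le_tmp.
have fr1 k : fr k < 1 by rewrite ltrBlDl -[X in _ + X]/(1%:~R) -rmorphD floorD1_gt.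
pose g (k : 'I_Q.+1) : 'I_Q := inord (Num.trunc (Q%:R * fr k)).
have gE k : nat_of_ord (g k) = Num.trunc (Q%:R * fr k).
  by rewrite inordK // truncn_lt_nat ?mulr_ge0 ?(ltW QR) // -[ltRHS]mulr1 ltr_pM2l.
have /injectivePn[i [j ij gij]] : ~~ injectiveb g.
  apply/injectiveP => /leq_card; rewrite !card_ord; lia.
have tij : Num.trunc (Q%:R * fr i) = Num.trunc (Q%:R * fr j).
  by rewrite -!gE gij.
wlog ltij : i j ij gij tij / (i < j)%N.
  move=> H; case: (ltngtP i j) => [h|h|/val_inj h]; first exact: (H i j).
    by apply: (H j i) => //; rewrite eq_sym.
  by rewrite h eqxx in ij.
have fi : 0 <= Q%:R * fr i by rewrite mulr_ge0 // ltW.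
have fj : 0 <= Q%:R * fr j by rewrite mulr_ge0 // ltW.
have /andP[a1 b1] := truncn_itv fi; have /andP[a2 b2] := truncn_itv fj.
rewrite -tij -natr1 in a2 b2; rewrite -natr1 in b1.
exists (Num.floor (j%:R * x) - Num.floor (i%:R * x)), (j - i)%N.
have qR : (0 : R) < (j - i)%:R by rewrite ltr0n subn_gt0.
split; [by rewrite subn_gt0| have := ltn_ord j; lia|].
rewrite invfM ler_pdivlMl //.
rewrite -{1}(gtr0_norm qR) -normrM mulrBr mulrCA mulfV ?gt_eqF // mulr1.
rewrite -[leRHS]mul1r ler_pdivlMr // -{1}(gtr0_norm QR) -normrM ler_norml.
have -> : (((j - i)%:R * x - (Num.floor (j%:R * x) - Num.floor (i%:R * x))%:~R)
   * Q%:R) = Q%:R * fr j - Q%:R * fr i.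
  by rewrite /fr natrB 1?ltnW // rmorphB /=; ring.
by apply/andP; split; lra.
Qed.

(** * Averaging over an interval *)

(** First moment argument: if the weighted number of intervals through [x] were at least [1] for all
    [x] in [[a, b]], its Lebesgue integral would be at least [b - a], yet it is at most [c]. *)
Lemma exists_sum_lt1 (R : realType) (a b c : R) (z rho v : nat -> R) :
  (forall k, 0 <= rho k) -> (forall k, 0 <= v k) ->
  (forall N, \sum_(k < N) v k * (2 * rho k) <= c) -> c < b - a -> a <= b ->
  exists2 x, a <= x <= b &
    forall N, \sum_(k < N | `|x - z k| <= rho k) v k < 1.
Proof.
move=> rho0 v0 sumc cab ab.
pose I k : set (measurableTypeR R) := `[z k - rho k, z k + rho k]%classic.
pose D : set (measurableTypeR R) := `[a, b]%classic.
pose f k (x : measurableTypeR R) : \bar R := ((v k)%:E * (\1_(I k) x)%:E)%E.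
have mD : measurable D by exact: measurable_itv.
have mI k : measurable (I k) by exact: measurable_itv.
have f0 k x : (0 <= f k x)%E by rewrite mule_ge0 // lee_fin.
have mf k : measurable_fun D (f k).
  apply: measurable_funeM; apply/measurable_EFinP.
  exact: measurable_indic.
have intf k : (\int[lebesgue_measure]_(x in D) f k x <= (v k * (2 * rho k))%:E)%E.
  rewrite ge0_integralZl//; last 2 first.
  - apply/measurable_EFinP; exact: measurable_indic.
  - by rewrite lee_fin.
  rewrite integral_indic // EFinM lee_wpmul2l ?lee_fin //.
  apply: (@le_trans _ _ (lebesgue_measure (I k))).
    by apply: le_measure; rewrite ?inE //; exact: measurableI.
  rewrite lebesgue_measure_itv /= lte_fin; case: ifP => _.
    by rewrite -EFinD lee_fin; lra.
  by rewrite lee_fin mulr_ge0.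
have tot : (\int[lebesgue_measure]_(x in D) \sum_(0 <= k <oo) f k x <= c%:E)%E.
  rewrite integral_nneseries //.
  apply: lime_le.
    apply: is_cvg_nneseries => k _ _; exact: integral_ge0.
  apply: nearW => N.
  apply: (@le_trans _ _ (\sum_(0 <= k < N) (v k * (2 * rho k))%:E)%E).
    by apply: lee_sum.
  by rewrite sumEFin lee_fin big_mkord.
have [x Dx lt1] : exists2 x, D x & (\sum_(0 <= k <oo) f k x < 1)%E.
  apply: contrapT => H.
  have ge1 x : D x -> (1 <= \sum_(0 <= k <oo) f k x)%E.
    by move=> Dx; rewrite leNgt; apply/negP => h; apply: H; exists x.
  have : ((b - a)%:E <= c%:E)%E; last by rewrite lee_fin leNgt cab.
  apply: le_trans tot.
  have muD : lebesgue_measure D = (b - a)%:E.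
    rewrite /D lebesgue_measure_itv /= lte_fin.
    case: ifP => [_|/negbT]; first by rewrite EFinD.
    by rewrite -leNgt => ba; have -> : b = a; [apply/le_anti/andP; split|rewrite subrr].
  rewrite -muD -[leLHS]mul1e -(integral_cst _ mD).
  apply: ge0_le_integral => //.
  all: try (by move=> *; exact: nneseries_ge0).
  all: try (exact: ge0_emeasurable_sum).
exists x; first by move: Dx; rewrite /D /= in_itv.
move=> N; rewrite -lte_fin; apply: le_lt_trans lt1.
apply: le_trans (nneseries_lim_ge N _); last by move=> *; exact: f0.
rewrite big_mkcond /= -sumEFin big_mkord; apply: lee_sum => k _.
rewrite /f indicE.
have -> : (x \in I k) = (`|x - z k| <= rho k).
  apply/idP/idP; rewrite inE /I /= in_itv /= ler_norml => /andP[? ?];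
  by apply/andP; split; lra.
by case: ifP => _; rewrite ?mule1 ?mule0.
Qed.

(** The finite list [S] is put in front of the sequence with weight [1], so a point of total weight
    below [1] misses every ball of [S]. *)
Lemma exists_avoid_sum_lt1 (R : realType) (a b c1 c2 : R) (S : seq (R * R))
    (z rho v : nat -> R) :
  (forall k, 0 <= rho k) -> (forall k, 0 <= v k) ->
  (forall p, p \in S -> 0 <= p.2) -> \sum_(p <- S) 2 * p.2 <= c1 ->
  (forall N, \sum_(k < N) v k * (2 * rho k) <= c2) -> c1 + c2 < b - a -> a <= b ->
  exists x, [/\ a <= x <= b, forall p, p \in S -> p.2 < `|x - p.1| &
    forall N, \sum_(k < N | `|x - z k| <= rho k) v k < 1].
Proof.
move=> rho0 v0 S0 Sc vc cab ab.
pose n := size S; pose o := (0 : R, 0 : R).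
pose z' k := if (k < n)%N then (nth o S k).1 else z (k - n)%N.
pose rho' k := if (k < n)%N then (nth o S k).2 else rho (k - n)%N.
pose v' k := if (k < n)%N then 1 else v (k - n)%N.
have r'0 k : 0 <= rho' k by rewrite /rho'; case: ltnP => // h; apply: S0; exact: mem_nth.
have v'0 k : 0 <= v' k by rewrite /v'; case: ltnP.
have [|x xab H] := @exists_sum_lt1 R a b (c1 + c2) z' rho' v' r'0 v'0 _ cab ab.
  move=> N; apply: (@le_trans _ _ (\sum_(k < n + N) v' k * (2 * rho' k))).
    rewrite -!(big_mkord xpredT (fun k => v' k * (2 * rho' k))).
    rewrite [leRHS](big_cat_nat (n := N)) ?leq_addl //= lerDl sumr_ge0 // => k _.
    by rewrite !mulr_ge0.
  rewrite big_split_ord /=; apply: lerD.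
    apply: le_trans Sc; rewrite (big_nth o) big_mkord le_eqVlt; apply/orP; left.
    by apply/eqP; apply: eq_bigr => k _; rewrite /v' /rho' ltn_ord mul1r.
  apply: le_trans (vc N); rewrite le_eqVlt; apply/orP; left; apply/eqP.
  by apply: eq_bigr => k _; rewrite /v' /rho' ltnNge leq_addr /= addKn.
exists x; split => //.
  move=> p pS; rewrite ltNge; apply/negP => h.
  have kn : (index p S < n)%N by rewrite index_mem.
  have := H n; rewrite (bigD1 (Ordinal kn)) /=; last first.
    by rewrite /z' /rho' kn nth_index.
  rewrite /v' kn ltNge lerDl => /negP[].
  by apply: sumr_ge0 => k _; exact: v'0.
move=> N; apply: le_lt_trans (H (n + N)%N).
rewrite big_split_ord /= [leRHS]addrC -[leLHS]addr0; apply: lerD.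
  rewrite le_eqVlt; apply/orP; left; apply/eqP.
  by apply: eq_big => k; rewrite /v' /z' /rho' ltnNge leq_addr /= addKn.
by apply: sumr_ge0 => k _; exact: v'0.
Qed.

(** * Hausdorff gauges and covers *)

Lemma diameter_le (R : realType) (U : set R) (d : R) :
  (forall x y, U x -> U y -> `|x - y| <= d) -> (diameter U <= d%:E)%E.
Proof.
by move=> H; apply: ge_ereal_sup => _ [[x y] [/= Ux Uy] <-]; rewrite lee_fin H.
Qed.

Lemma le_diameter (R : realType) (U : set R) (x y : R) :
  U x -> U y -> (`|x - y|%:E <= diameter U)%E.
Proof. by move=> Ux Uy; apply: ereal_sup_ubound; exists (x, y). Qed.

Lemma hausdorff_gauge_ge0 (R : realType) (s : R) (U : set R) :
  (0 <= hausdorff_gauge s U)%E.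
Proof. by rewrite /hausdorff_gauge; case: pselect => // ?; exact: poweR_ge0. Qed.

Lemma hausdorff_gauge_set0 (R : realType) (s : R) :
  hausdorff_gauge s (set0 : set R) = 0%E.
Proof. by rewrite /hausdorff_gauge; case: pselect. Qed.

Lemma hausdorff_gauge_le (R : realType) (s d : R) (U : set R) :
  0 <= s -> 0 <= d -> (diameter U <= d%:E)%E ->
  (hausdorff_gauge s U <= (d `^ s)%:E)%E.
Proof.
move=> s0 d0 Ud; rewrite /hausdorff_gauge; case: pselect => U0.
  by rewrite lee_fin powR_ge0.
have /set0P[x Ux] : U != set0 by exact/eqP.
have := le_diameter Ux Ux; rewrite subrr normr0 => D0.
by rewrite -poweR_EFin; apply: gt0_ler_poweR; rewrite ?in_itv /= ?D0 ?lee_fin ?d0 ?leey.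
Qed.

(** Serves to raise the exponent of a cover: powers of a number in []0, 1]] decrease with the
    exponent, and [0 < s1] makes singletons contribute [0] on the left even if [s = 0]. *)
Lemma diameter_powR_le_gauge (R : realType) (s s1 : R) (U : set R) :
  0 <= s <= s1 -> 0 < s1 -> U !=set0 -> (diameter U <= 1)%E ->
  ((fine (diameter U) `^ s1)%:E <= hausdorff_gauge s U)%E.
Proof.
move=> /andP[s0 ss1] s10 [x Ux] D1.
have D0 := le_diameter Ux Ux; rewrite subrr normr0 in D0.
rewrite /hausdorff_gauge; case: pselect => U0; first by rewrite U0 in Ux.
case: (diameter U) D0 D1 => [r| |] //=; rewrite !lee_fin => r0 r1.
move: r0; rewrite le_eqVlt => /orP[/eqP <-|r0].
  by rewrite powR0 ?gt_eqF // powR_ge0.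
by rewrite ger_powR // r0.
Qed.

Lemma hausdorff_measure_eq0P (R : realType) (s : R) (A : set R) :
  hausdorff_measure s A = 0%E <->
  forall d e, 0 < d -> 0 < e -> exists F : (set R)^nat,
    delta_cover d A F /\ (\sum_(0 <= i <oo) hausdorff_gauge s (F i) <= e%:E)%E.
Proof.
have ge0 d : (0 <= hausdorff_premeasure s d A)%E.
  apply: le_ereal_inf_tmp => _ [F _ <-]; apply: nneseries_ge0 => *.
  exact: hausdorff_gauge_ge0.
split=> [H0 d e d0 e0|H].
  have pd : (hausdorff_premeasure s d A <= 0)%E.
    by rewrite -H0; apply: ereal_sup_ubound; exists d.
  have {}pd : hausdorff_premeasure s d A = 0%E by apply/le_anti/andP.
  have fin : hausdorff_premeasure s d A \is a fin_num by rewrite pd.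
  have [_ [F dF <-] lt] := lb_ereal_inf_adherent e0 fin.
  exists F; split => //; apply: ltW; apply: lt_le_trans lt _.
  by move: pd; rewrite /hausdorff_premeasure => ->; rewrite add0e.
apply/le_anti/andP; split; last first.
  apply: le_trans (ge0 1) _; apply: ereal_sup_ubound; exists 1 => //=.
apply: ge_ereal_sup => _ [d /= d0 <-].
apply/lee_addgt0Pr => e e0; rewrite add0e.
have [F [dF le]] := H _ _ d0 e0.
by apply: le_trans le; apply: ereal_inf_lbound; exists F.
Qed.

(** Countable subadditivity at the level of covers: the covers of the [B k] are enumerated along a
    bijection between [nat] and pairs, and the nonnegative double series is rearranged. *)
Lemma delta_cover_bigcup (R : realType) (s d : R) (B : nat -> set R)
    (e : nat -> \bar R) :
  (forall k, exists F : (set R)^nat, delta_cover d (B k) F /\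
     (\sum_(0 <= i <oo) hausdorff_gauge s (F i) <= e k)%E) ->
  exists F : (set R)^nat, delta_cover d (\bigcup_k B k) F /\
     (\sum_(0 <= i <oo) hausdorff_gauge s (F i) <= \sum_(0 <= k <oo) e k)%E.
Proof.
move=> /choice[G PG].
pose g (p : nat * nat) := hausdorff_gauge s (G p.1 p.2).
have g0 p : (0 <= g p)%E by exact: hausdorff_gauge_ge0.
have /card_esym/ppcard_eqP[f] := card_nat2.
exists (fun n => G (f n).1 (f n).2); split.
  split=> [x [k _ Bx]|i]; last by have [[_ h] _] := PG (f i).1; exact: h.
  have [[cov _] _] := PG k; have [j _ Gx] := cov _ Bx.
  by exists (f^-1%FUN (k, j)) => //=; rewrite invK ?inE.
apply: (@le_trans _ _ (\sum_(0 <= k <oo) \sum_(0 <= i <oo) g (k, i))%E); last first.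
  apply: lee_nneseries => [*|k *]; first exact: nneseries_ge0.
  by have [_] := PG k.
rewrite (nneseries_esum (a := fun n => g (f n))) //.
rewrite nneseries_esum; last by move=> k _; apply: nneseries_ge0.
have -> : (\esum_(k in [set k : nat | xpredT k]) (\sum_(0 <= i <oo) g (k, i)) =
   \esum_(k in [set: nat]) \esum_(i in [set: nat]) g (k, i))%E.
  have -> : [set k : nat | xpredT k] = [set: nat] by apply/seteqP.
  apply: eq_esum => k _; rewrite nneseries_esum //.
  by congr esum; apply/seteqP.
rewrite esum_esum //.
have -> : [set k : nat | xpredT k] = [set: nat] by apply/seteqP.
have -> : [set: nat] `*`` (fun=> [set: nat]) = [set: nat * nat] by apply/seteqP.
rewrite (reindex_esum [set: nat] [set: nat * nat] f) //.
Qed.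

(** Numbers the admissible numerators by naturals, so that they can index a finite cover. *)
Lemma int_ball_shift (R : realType) (p : int) (n : nat) : `|p%:~R| <= n%:R :> R ->
  exists2 j : nat, p = j%:Z - n%:Z & (j <= 2 * n)%N.
Proof.
rewrite -[n%:R]/(n%:Z%:~R) -intr_norm ler_int ler_norml => /andP[p1 p2].
by exists (absz (p + n%:Z)); lia.
Qed.

Lemma delta_cover_finite (R : realType) (s d c : R) (N : nat)
    (F : nat -> set R) : 0 <= s -> 0 <= c <= d ->
  (forall i, (i < N)%N -> (diameter (F i) <= c%:E)%E) ->
  exists G : (set R)^nat, delta_cover d (\bigcup_(i < N) F i) G /\
     (\sum_(0 <= i <oo) hausdorff_gauge s (G i) <= (N%:R * c `^ s)%:E)%E.
Proof.
move=> s0 /andP[c0 cd] Fc.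
(* Padding with [set0] is free, even for [s = 0]. *)
exists (fun i => if (i < N)%N then F i else set0); split.
  split=> [x [i /= iN Fx]|i]; first by exists i => //=; rewrite iN.
  case: ifP => [/Fc h|_]; first by apply: le_trans h _; rewrite lee_fin.
  by apply: diameter_le.
rewrite (nneseries_split _ N) => [|k _]; last exact: hausdorff_gauge_ge0.
rewrite add0n [X in (_ + X)%E]eseries0 => [|i Ni _]; last first.
  by rewrite ltnNge Ni /= hausdorff_gauge_set0.
rewrite adde0.
apply: (@le_trans _ _ (\sum_(0 <= i < N) (c `^ s)%:E)%E).
  rewrite !big_mkord; apply: lee_sum => i _; rewrite ltn_ord.
  exact: hausdorff_gauge_le (Fc _ _).
by rewrite sumEFin lee_fin sumr_const_nat subn0 mulr_natl.
Qed.

(** * Upper bound: covers by annuli *)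

(** For [q < Q] the bound on [Psi] confines [p] to a finite range, so infinitely many pairs cannot
    all have denominators below [Q]. *)
Lemma W_unbounded (R : realType) (Psi : R -> R) (M x : R) (Q : nat) :
  (forall q, (0 < q)%N -> Psi q%:R <= M) -> W Psi x ->
  exists (p : int) (q : nat), [/\ (Q <= q)%N, (0 < q)%N &
    `|x - p%:~R / q%:R| <= Psi q%:R].
Proof.
move=> PM Wx; apply: contrapT => H; apply: Wx.
pose L := (Num.trunc (Q%:R * (`|x| + M))).+1.
pose h (iq : nat * nat) := ((iq.1%:Z - L%:Z)%R, iq.2).
apply: (@sub_finite_set _ _ (h @` (`I_(2 * L).+1 `*` `I_Q))); last first.
  by apply: finite_image; apply: finite_setX; exact: finite_II.
move=> [p q] [/= q0 xp].
have qQ : (q < Q)%N.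
  by rewrite ltnNge; apply/negP => Qq; apply: H; exists p, q.
have qR : (0 : R) < q%:R by rewrite ltr0n.
have pL : `|p%:~R| <= L%:R :> R.
  apply: ltW; apply: le_lt_trans (truncnS_gt _).
  have M0 : 0 <= M by apply: le_trans (PM _ q0); apply: le_trans xp.
  apply: (@le_trans _ _ (q%:R * (`|x| + M))); last first.
    by rewrite ler_wpM2r ?addr_ge0 // ler_nat ltnW.
  rewrite -ler_pdivrMl // mulrC -[X in _ * X](gtr0_norm) ?invr_gt0 // -normrM.
  have : `|p%:~R / q%:R| <= `|x| + `|x - p%:~R / q%:R|.
    by rewrite -{1}[p%:~R / q%:R](subKr x); exact: ler_normB.
  by move/le_trans; apply; rewrite lerD2l (le_trans xp) // PM.
have [j -> jL] := int_ball_shift pL.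
by exists (j, q); split.
Qed.

(** [E] is exhausted by pieces [EK K] with uniform bounds on [|x|] and on the threshold of the lower
    inequality. At denominator [q] a piece needs a number of intervals of order [q], so a tail of
    the convergent series bounds its cost; the budgets of the pieces sum to at most [e]. *)
Lemma hausdorff_measure_E_eq0 (R : realType) (Psi omega : R -> R) (s : R)
  (Psi_gt0 : forall q : R, 0 < q -> 0 < Psi q)
  (omega_itv : forall q : R, 0 < q -> 0 < omega q < 1)
  (Psi_noninc : forall q r : R, 0 < q -> q <= r ->
    r ^+ 2 * Psi r <= q ^+ 2 * Psi q) :
  0 <= s ->
  (\sum_(1 <= q <oo) (q%:R * (Psi q%:R * omega q%:R) `^ s)%:E < +oo)%E ->
  hausdorff_measure s (E Psi omega) = 0%E.
Proof.
move=> s0 sum_fin; apply/hausdorff_measure_eq0P => d e d0 e0.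
pose g (q : nat) : R := Psi q%:R * omega q%:R.
pose a (q : nat) : R := q%:R * g q `^ s.
have a0 q : 0 <= a q by rewrite mulr_ge0 ?powR_ge0.
have g0 q : (0 < q)%N -> 0 < g q.
  move=> q0; have qR : (0 : R) < q%:R by rewrite ltr0n.
  by rewrite mulr_gt0 ?Psi_gt0 //; have /andP[] := omega_itv _ qR.
have Psi_le q : (0 < q)%N -> q%:R * Psi q%:R <= Psi 1.
  move=> q0; have := @Psi_noninc 1 q%:R ltr01; rewrite ler1n => /(_ q0).
  rewrite expr1n mul1r; apply: le_trans.
  by rewrite ler_wpM2r ?(ltW (Psi_gt0 _ _)) ?ltr0n // expr2 ler_peMl ?ler1n.
have Psi_le1 q : (0 < q)%N -> Psi q%:R <= Psi 1.
  move=> q0; apply: le_trans (Psi_le _ q0).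
  by rewrite ler_peMl ?ler1n // ?(ltW (Psi_gt0 _ _)) ?ltr0n.
have gPsi q : (0 < q)%N -> g q <= Psi q%:R.
  move=> q0; have qR : (0 : R) < q%:R by rewrite ltr0n.
  by rewrite ler_piMr ?(ltW (Psi_gt0 _ _)) //; have /andP[_ /ltW] := omega_itv _ qR.
pose M := (Num.trunc (Psi 1)).+1.
have PM : Psi 1 <= M%:R by rewrite ltW // truncnS_gt.
pose EK (K : nat) : set R := [set x | [/\ W Psi x, `|x| <= K%:R &
   forall q, (K <= q)%N -> forall p : int,
     `|x - p%:~R / q%:R| >= (1 - omega q%:R) * Psi q%:R]].
have EE : E Psi omega `<=` \bigcup_K EK K.
  move=> x [Wx [N _ HN]]; exists (maxn N (Num.trunc `|x|).+1) => //; split => //.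
    apply: (@le_trans _ _ (Num.trunc `|x|).+1%:R).
      by rewrite ltW // truncnS_gt.
    by rewrite ler_nat leq_maxr.
  by move=> q; rewrite geq_max => /andP[/HN].
have sum0 : (\sum_(0 <= q <oo) (a q)%:E < +oo)%E.
  rewrite (nneseries_split _ 1) => [|k _]; last by rewrite lee_fin.
  by rewrite add0n big_nat1 /a mul0r add0e.
have tail : forall c : R, 0 < c -> exists Q, forall Q', (Q <= Q')%N ->
    (\sum_(Q' <= q <oo) (a q)%:E <= c%:E)%E.
  move=> c c0.
  have /(_ _) tl := @nneseries_tail_cvg R (fun q => (a q)%:E) xpredT sum0.
  have {}tl := tl (fun k _ => a0 k).
  have [Q _ HQ] := tl _ (@nbhs_open_ereal_lt R 0 (fun=> c) c0).
  by exists Q => Q' /HQ /ltW.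
suff H K : exists F : (set R)^nat, delta_cover d (EK K) F /\
     (\sum_(0 <= i <oo) hausdorff_gauge s (F i) <= (e / (2 ^ K.+1)%:R)%:E)%E.
  have [F [[cov dF] sF]] := delta_cover_bigcup H.
  exists F; split; first by split => //; exact: subset_trans EE cov.
  apply: le_trans sF _; apply: epsilon_trick0; exact: ltW.
(* Approximants [p / q] of points of [EK K] have [|p| <= q * P], since [|p / q| <= |x| + Psi q]. *)
pose P := (K + M)%N.
have P0 : (0 < P)%N by rewrite /P /M addnS.
have PR : (0 : R) < P%:R by rewrite ltr0n.
have c0 : 0 < e / (2 ^ K.+1)%:R / (6 * P%:R).
  by rewrite !divr_gt0 ?mulr_gt0 // ?ltr0n ?expn_gt0.
have [Q HQ] := tail _ c0.
(* From [Q1] on, the tail is small, the lower inequality holds on [EK K], and the intervals have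
   length at most [d], because [g q <= Psi q <= Psi 1 / q]. *)
pose Q1 := maxn Q (maxn K (Num.trunc (Psi 1 / d)%R).+1).
have Q1Q : (Q <= Q1)%N by rewrite leq_maxl.
have Q1K : (K <= Q1)%N by rewrite /Q1 !leq_max leqnn orbT.
have Q1d : ((Num.trunc (Psi 1 / d)%R).+1 <= Q1)%N by rewrite /Q1 !leq_max leqnn !orbT.
(* The parity of [i] chooses the side of the rational (odd: right), and [i./2 - q * P] is its
   numerator. *)
pose iv q i : set R := let z := (i./2%:R - (q * P)%:R) / q%:R in
  if odd i then `[z + (1 - omega q%:R) * Psi q%:R, z + Psi q%:R]%classic
  else `[z - Psi q%:R, z - (1 - omega q%:R) * Psi q%:R]%classic.
have ivd q i : (diameter (iv q i) <= (g q)%:E)%E.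
  apply: diameter_le => x y; rewrite /iv /g /=.
  move: (Psi _) (omega _) ((_ - _) / _) => P' w z.
  case: ifP => _ /=; rewrite !in_itv /= mulrBl mul1r => /andP[x1 x2] /andP[y1 y2];
  rewrite ler_norml; apply/andP; split; lra.
(* Two sides for each of [2 * q * P + 1] numerators: at most [6 * q * P] intervals. *)
pose N q := (2 * (2 * (q * P)).+1)%N.
have NP q : (0 < q)%N -> (N q)%:R * g q `^ s <= 6 * P%:R * a q.
  move=> q0; rewrite /a mulrA ler_wpM2r ?powR_ge0 // -!natrM ler_nat /N.
  have := muln_gt0 q P; rewrite q0 P0 -mulnA (mulnC P); lia.
have Hk k : exists F : (set R)^nat,
  delta_cover d (\bigcup_(i < N (k + Q1)%N) iv (k + Q1)%N i) F /\
     (\sum_(0 <= i <oo) hausdorff_gauge s (F i) <=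
       (6 * P%:R * a (k + Q1)%N)%:E)%E.
  have q0 : (0 < k + Q1)%N by rewrite addn_gt0 (leq_ltn_trans _ Q1d) ?orbT.
  have gd : g (k + Q1)%N <= d.
    apply: le_trans (gPsi _ q0) _; rewrite -(@ler_pM2l _ (k + Q1)%:R) ?ltr0n //.
    apply: le_trans (Psi_le _ q0) _; rewrite -ler_pdivrMr //.
    apply: le_trans (ltW (truncnS_gt _)) _; rewrite ler_nat.
    exact: leq_trans Q1d (leq_addl _ _).
  have [F [dF sF]] := @delta_cover_finite R s d (g (k + Q1)%N) (N (k + Q1)%N)
     (iv (k + Q1)%N) s0 ltac:(by rewrite gd ltW ?g0) (fun i _ => ivd _ i).
  exists F; split => //; apply: le_trans sF _; rewrite lee_fin; exact: NP.
have [F [[cov dF] sF]] := delta_cover_bigcup Hk.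
exists F; split; last first.
  apply: le_trans sF _.
  under eq_eseriesr do rewrite EFinM.
  rewrite nneseriesZl => [|k _]; last by rewrite lee_fin.
  rewrite (nneseries_addn Q1 (f := fun q => (a q)%:E)) => [|k]; last by rewrite lee_fin.
  have := HQ _ Q1Q; rewrite -(@lee_pmul2l _ (6 * P%:R)%:E) // ?lte_fin ?mulr_gt0 //.
  move=> /le_trans; apply; rewrite -EFinM lee_fin le_eqVlt; apply/orP; left.
  by apply/eqP; rewrite mulrC divfK // gt_eqF // mulr_gt0.
split=> // x [Wx xK xE]; apply: cov.
have [p [q [Qq q0 xp]]] := W_unbounded Q1 Psi_le1 Wx.
exists (q - Q1)%N => //; rewrite subnK //.
have qR : (0 : R) < q%:R by rewrite ltr0n.
have pL : `|p%:~R| <= (q * P)%:R :> R.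
  rewrite natrM -ler_pdivrMl // mulrC -[X in _ * X](gtr0_norm) ?invr_gt0 // -normrM.
  have : `|p%:~R / q%:R| <= `|x| + `|x - p%:~R / q%:R|.
    by rewrite -{1}[p%:~R / q%:R](subKr x); exact: ler_normB.
  move/le_trans; apply; rewrite natrD lerD // (le_trans xp) //.
  exact: le_trans (Psi_le1 _ q0) _.
have xE' := xE q (leq_trans Q1K Qq) p.
have [j pj jN] := int_ball_shift pL.
have jE : p%:~R = j%:R - (q * P)%:R :> R by rewrite pj rmorphB /= -!pmulrn.
pose o := 0 <= x - p%:~R / q%:R.
exists (o + j.*2)%N => /=. 
  rewrite /N -muln2 [(j * 2)%N]mulnC mulnS -addSn.
  by apply: leq_add; [case: (o)|rewrite leq_mul2l].
rewrite /iv half_bit_double oddD odd_double addbF -jE.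
have -> : odd o = o by case: o.
rewrite /o; case: leP => h; rewrite /= in_itv /=.
  by rewrite ger0_norm // in xp xE'; apply/andP; split; lra.
by rewrite ltr0_norm // in xp xE'; apply/andP; split; lra.
Qed.

(** * Dyadic condensation of the series *)

(** Monotonicity of [q^2 * Psi q] bounds each of the [2^k] terms of the block below by
    [2^(k+1) * Psi (2^(k+1))]. *)
Lemma dyadic_block_ge (R : realType) (Psi : R -> R) (k : nat)
  (Psi_noninc : forall q r : R, 0 < q -> q <= r ->
    r ^+ 2 * Psi r <= q ^+ 2 * Psi q) : 0 <= Psi (2 ^+ k.+1) ->
  4 ^+ k.+1 * Psi (2 ^+ k.+1) <=
    2 * \sum_((2 ^ k)%N <= q < (2 ^ k.+1)%N) q%:R * Psi q%:R.
Proof.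
move=> P0; set P := Psi _ in P0 *.
have pos : (0 : R) < 2 ^+ k by rewrite exprn_gt0.
rewrite -ler_pdivrMl //.
apply: (@le_trans _ _ (\sum_((2 ^ k)%N <= q < (2 ^ k.+1)%N) 2 ^+ k.+1 * P)).
  rewrite sumr_const_nat expnS mul2n -addnn addnK -[leRHS]mulr_natl natrX (_ : 4 = 2 * 2 :> R); last by rewrite -natrM.
  by rewrite exprMn !exprS; lra.
apply: ler_sum_nat => q /andP[q1 q2].
have q0 : (0 : R) < q%:R by rewrite ltr0n; apply: leq_trans q1; rewrite expn_gt0.
have qle : q%:R <= 2 ^+ k.+1 :> R by rewrite -natrX ler_nat ltnW.
have := Psi_noninc _ _ q0 qle; rewrite -/P => h.
rewrite -(ler_pM2l q0); apply: (@le_trans _ _ ((2 ^+ k.+1) ^+ 2 * P)).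
  by rewrite mulrA expr2; apply: ler_wpM2r => //; apply: ler_wpM2r => //; rewrite exprn_ge0.
by rewrite mulrA -expr2.
Qed.

Lemma dyadic_sum_tail (R : realType) (Psi : R -> R)
  (Psi_gt0 : forall q : R, 0 < q -> 0 < Psi q)
  (Psi_noninc : forall q r : R, 0 < q -> q <= r ->
    r ^+ 2 * Psi r <= q ^+ 2 * Psi q)
  (Psi_summable : (\sum_(1 <= q <oo) (q%:R * Psi q%:R)%:E < +oo)%E)
  (eps : R) : 0 < eps ->
  exists m0, forall m n, (m0 <= m)%N ->
    \sum_(m <= j < n) 4 ^+ j * Psi (2 ^+ j) <= eps.
Proof.
move=> e0; pose a (q : nat) : R := q%:R * Psi q%:R.
have a0 q : 0 <= a q.
  rewrite /a; case: q => [|q]; first by rewrite mul0r.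
  by rewrite mulr_ge0 // ltW // Psi_gt0.
have sum0 : (\sum_(0 <= q <oo) (a q)%:E < +oo)%E.
  rewrite (nneseries_split _ 1) => [|k _]; last by rewrite lee_fin.
  by rewrite add0n big_nat1 /a mul0r add0e.
have tl := @nneseries_tail_cvg R (fun q => (a q)%:E) xpredT sum0 (fun k _ => a0 k).
have e20 : 0 < eps / 2 by rewrite divr_gt0.
have [Q _ HQ] := tl _ (@nbhs_open_ereal_lt R 0 (fun=> eps / 2) e20).
have {HQ} tailQ P N : (Q <= P)%N -> \sum_(P <= q < N) a q <= eps / 2.
  move=> /HQ /= h; rewrite -lee_fin; apply: le_trans (ltW h).
  rewrite -sumEFin; apply: nneseries_lim_ge => k _ _; rewrite lee_fin; exact: a0.
(* The shift by one is due to the term at [j] being paid by the block that ends at [2^j]. *)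
exists Q.+1 => -[//|m] n; rewrite ltnS => Qm.
suff H k : \sum_(m.+1 <= j < m.+1 + k) 4 ^+ j * Psi (2 ^+ j) <=
    2 * \sum_((2 ^ m)%N <= q < (2 ^ (m + k))%N) a q.
  have [nm|mn] := leqP n m.+1; first by rewrite big_geq // ltW.
  rewrite -(subnKC (ltnW mn)); apply: le_trans (H _) _.
  rewrite -ler_pdivlMl // mulrC; apply: tailQ.
  by apply: leq_trans Qm _; rewrite ltnW // ltn_expl.
elim: k => [|k IH]; first by rewrite !addn0 !big_geq // mulr0.
rewrite addnS [leLHS]big_nat_recr ?leq_addr //=.
rewrite [X in 2 * X](big_cat_nat (n := (2 ^ (m + k))%N)) ?leq_exp2l ?leq_addr //=;
  last by rewrite addnS.
rewrite mulrDr; apply: lerD => //; rewrite addSn addnS.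
by apply: dyadic_block_ge => //; rewrite ltW // Psi_gt0 // exprn_gt0.
Qed.

(** Raising the bound to the power [r = s2 / s1 > 1] gives [4^j * g (2^j)^s2 <= M^r * rho^j] with
    [rho = 4^(1 - r) < 1]. The block from [2^j] to [2^(j+1)] is at most twice the left side, so the
    blocks are dominated by a geometric series. *)
Lemma summable_of_dyadic_bounded (R : realType) (g : nat -> R) (s1 s2 M : R) :
  (forall q, (0 < q)%N -> 0 < g q) ->
  (forall q r, (0 < q)%N -> (q <= r)%N -> g r <= g q) ->
  0 < s1 < s2 -> (forall j, 4 ^+ j * g (2 ^ j)%N `^ s1 <= M) ->
  (\sum_(1 <= q <oo) (q%:R * g q `^ s2)%:E < +oo)%E.
Proof.
move=> g0 gle /andP[s10 s12] HM.
have s20 : 0 < s2 by exact: lt_trans s12.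
pose a (q : nat) : R := q%:R * g q `^ s2.
have a0 q : 0 <= a q by rewrite mulr_ge0 ?powR_ge0.
pose r := s2 / s1; have r1 : 1 < r by rewrite ltr_pdivlMr // mul1r.
pose rho : R := 4 `^ (1 - r).
have rho0 : 0 < rho by rewrite powR_gt0.
have rho1 : rho < 1.
  have : 1 `^ (r - 1) < 4 `^ (r - 1) :> R.
    by apply: gt0_ltr_powR; rewrite ?nnegrE ?subr_gt0 ?ltr1n.
  by rewrite powR1 /= /rho -(opprB r 1) powRN invf_lt1 ?powR_gt0.
have M0 : 0 <= M by apply: le_trans (HM 0); rewrite mulr_ge0 ?powR_ge0 ?exprn_ge0.
have term j : 4 ^+ j * g (2 ^ j)%N `^ s2 <= M `^ r * rho ^+ j.
  have p4 : (0 : R) < 4 ^+ j by rewrite exprn_gt0.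
  have -> : g (2 ^ j)%N `^ s2 = (g (2 ^ j)%N `^ s1) `^ r.
    by rewrite -powRrM /r mulrCA mulfV ?mulr1 // gt_eqF.
  have h : g (2 ^ j)%N `^ s1 <= M * (4 ^+ j)^-1.
    by rewrite ler_pdivlMr // mulrC.
  apply: (@le_trans _ _ (4 ^+ j * (M * (4 ^+ j)^-1) `^ r)).
    rewrite ler_pM2l //; apply: ge0_ler_powR => //; rewrite ?nnegrE ?powR_ge0 //.
      by rewrite (le_trans _ (ltW r1)).
    by rewrite mulr_ge0 // invr_ge0 ltW.
  rewrite powRM ?invr_ge0 ?(ltW p4) // mulrCA ler_wpM2l ?powR_ge0 //.
  rewrite -powR_mulrn // -powRN -powRrM -powRD; last by rewrite pnatr_eq0 implybT.
  by rewrite -powR_mulrn ?powR_ge0 // -powRrM; rewrite le_eqVlt; apply/orP; left;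
    apply/eqP; congr powR; ring.
have block j : \sum_((2 ^ j)%N <= q < (2 ^ j.+1)%N) a q <= 2 * (M `^ r * rho ^+ j).
  apply: (@le_trans _ _ (\sum_((2 ^ j)%N <= q < (2 ^ j.+1)%N) 2 ^+ j.+1 * g (2 ^ j)%N `^ s2)).
    apply: ler_sum_nat => q /andP[q1 q2]; apply: ler_pM; rewrite ?powR_ge0 //.
      by rewrite -natrX ler_nat ltnW.
    have q0 : (0 < q)%N by apply: leq_trans q1; rewrite expn_gt0.
    apply: ge0_ler_powR; rewrite ?nnegrE ?(ltW s20) ?(ltW (g0 _ _)) ?expn_gt0 //.
    by apply: gle => //; rewrite expn_gt0.
  apply: le_trans (_ : 2 * (4 ^+ j * g (2 ^ j)%N `^ s2) <= _); last first.
    by rewrite ler_pM2l.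
  rewrite sumr_const_nat expnS mul2n -addnn addnK -[leLHS]mulr_natl natrX (_ : 4 = 2 * 2 :> R); last by rewrite -natrM.
  by rewrite exprMn !exprS; lra.
have geo n : \sum_(0 <= j < n) rho ^+ j <= (1 - rho)^-1.
  have r10 : 0 < 1 - rho by rewrite subr_gt0.
  rewrite -[leRHS]mul1r ler_pdivlMr // big_mkord.
  by have := subrX1 rho n; have := exprn_ge0 n (ltW rho0); lra.
have part n : \sum_(1 <= q < (2 ^ n)%N) a q <= 2 * (M `^ r * (1 - rho)^-1).
  apply: (@le_trans _ _ (2 * (M `^ r * \sum_(0 <= j < n) rho ^+ j))); last first.
    by rewrite ler_pM2l // ler_wpM2l ?powR_ge0.
  elim: n => [|n IH]; first by rewrite !big_geq // !mulr0.
  rewrite (big_cat_nat (n := (2 ^ n)%N)) ?leq_exp2l ?expn_gt0 //=.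
  by rewrite big_nat_recr //= !mulrDr; apply: lerD.
apply: (@le_lt_trans _ _ (2 * (M `^ r * (1 - rho)^-1))%:E); last exact: ltry.
apply: lime_le; first by apply: is_cvg_nneseries => k _ _; rewrite lee_fin; exact: a0.
apply: nearW => n; rewrite sumEFin lee_fin; apply: le_trans (part n).
have [n1|n1] := leqP n 1; first by rewrite big_geq // sumr_ge0.
rewrite [leRHS](big_cat_nat (n := n)) /=; [|exact: ltnW|by rewrite ltnW // ltn_expl].
by rewrite lerDl sumr_ge0.
Qed.

(** Provides the scales of the construction. Were the quantity at most [M] from [N] on, adding its
    first [N] values would bound it everywhere and force convergence at [s2]. *)
Lemma dyadic_unbounded (R : realType) (g : nat -> R) (s1 s2 M : R) (N : nat) :
  (forall q, (0 < q)%N -> 0 < g q) ->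
  (forall q r, (0 < q)%N -> (q <= r)%N -> g r <= g q) ->
  0 < s1 < s2 -> ~ (\sum_(1 <= q <oo) (q%:R * g q `^ s2)%:E < +oo)%E ->
  exists2 n, (N <= n)%N & M < 4 ^+ n * g (2 ^ n)%N `^ s1.
Proof.
move=> g0 gle s12 div; apply: contrapT => H; apply: div.
pose b j : R := 4 ^+ j * g (2 ^ j)%N `^ s1.
have b0 j : 0 <= b j by rewrite mulr_ge0 ?powR_ge0 ?exprn_ge0.
apply: (@summable_of_dyadic_bounded R g s1 s2 (`|M| + \sum_(j < N) b j)) => // j.
have [Nj|jN] := leqP N j.
  rewrite -/(b j) -[leLHS]addr0 lerD ?sumr_ge0 // (le_trans _ (ler_norm M)) //.
  by rewrite leNgt; apply/negP => h; apply: H; exists j.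
rewrite (bigD1 (Ordinal jN)) //= addrCA -[leLHS]addr0 lerD // addr_ge0 //.
exact: sumr_ge0.
Qed.

(** * Good points: lengths excluded by rationals and by balls *)

(** A pair [(T, d)] of [ts] demands distance more than [d] from all rationals of denominator below
    [T]. Those that matter lie in [[a - d, b + d]], where [rat_cells] counts them, and each excludes
    a length [2 * d]. *)
Lemma exists_avoid_rats (R : realType) (a b c1 c2 : R) (ts : seq (nat * R))
    (z rho v : nat -> R) :
  (forall k, 0 <= rho k) -> (forall k, 0 <= v k) ->
  (forall p, p \in ts -> (0 < p.1)%N /\ 0 <= p.2) ->
  \sum_(p <- ts) (p.1%:R ^+ 2 * (b - a + 2 * p.2) + 1) * (2 * p.2) <= c1 ->
  (forall N, \sum_(k < N) v k * (2 * rho k) <= c2) -> c1 + c2 < b - a -> a <= b ->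
  exists x, [/\ a <= x <= b,
    forall p, p \in ts -> forall (r : int) t, (0 < t)%N -> (t < p.1)%N ->
      p.2 < `|x - r%:~R / t%:R| &
    forall N, \sum_(k < N | `|x - z k| <= rho k) v k < 1].
Proof.
move=> rho0 v0 ts0 tsc vc cab ab.
have [S [S0 Sc SP]] : exists S : seq (R * R), [/\ forall p, p \in S -> 0 <= p.2,
    \sum_(p <- S) 2 * p.2 <=
      \sum_(p <- ts) (p.1%:R ^+ 2 * (b - a + 2 * p.2) + 1) * (2 * p.2) &
    forall p, p \in ts -> forall (r : int) t, (0 < t)%N -> (t < p.1)%N ->
      a - p.2 <= r%:~R / t%:R <= b + p.2 -> (r%:~R / t%:R, p.2) \in S].
  elim: ts ts0 {tsc} => [|p ts IH] ts0.
    by exists [::]; rewrite !big_nil; split.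
  have [|S [S0 Sc SP]] := IH.
    by move=> p' p'ts; apply: ts0; rewrite inE p'ts orbT.
  have [T0 p0] := ts0 p (mem_head _ _).
  have ell0 : 0 <= b - a + 2 * p.2 by lra.
  have [s [ss sP]] := rat_cells (a - p.2) T0 ell0.
  exists ([seq (y, p.2) | y <- s] ++ S); split.
  - by move=> p'; rewrite mem_cat => /orP[/mapP[y _ ->]|/S0].
  - rewrite big_cat big_map big_cons /=; apply: lerD => //.
    by rewrite big_const_seq count_predT iter_addr_0 -[leLHS]mulr_natl ler_wpM2r // mulr_ge0.
  - move=> p'; rewrite inE => /orP[/eqP ->|p'ts] r t t0 tT h; rewrite mem_cat.
      by apply/orP; left; apply: map_f; apply: sP => //; lra.
    by rewrite (SP p') ?orbT.
have [x [xab xS xN]] := @exists_avoid_sum_lt1 R a b c1 c2 S z rho v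
  rho0 v0 S0 (le_trans Sc tsc) vc cab ab.
exists x; split => // p pts r t t0 tT; rewrite ltNge; apply/negP => h.
have := xS _ (SP p pts r t t0 tT _); rewrite /= ltNge h => H.
by apply: notF; apply: H; move: h xab; rewrite ler_norml; lra.
Qed.

(** The assumption [1/20 <= 4^m * lam] absorbs the [+ 1] of the cell count into its main term, so
    level [j] costs at most [252 * lam * 4^j * P j]; the constant is generous, and
    [252 / 4096 < 1 / 16]. *)
Lemma psi_excluded_length (R : realType) (lam : R) (P : nat -> R) (m n : nat) :
  1 / 20 <= 4 ^+ m * lam -> (forall j, 0 <= P j) ->
  (forall n, \sum_(m <= j < n) 4 ^+ j * P j <= 1 / 4096) ->
  \sum_(m <= j < n) (((2 ^ j.+1)%N%:R ^+ 2 * (lam / 2 + 2 * (3 * P j)) + 1)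
      * (2 * (3 * P j))) <= lam / 16.
Proof.
move=> lam0 P0 HP.
have m0 : (0 : R) < 4 ^+ m by rewrite exprn_gt0.
have lamp : 0 < lam by rewrite -(pmulr_rgt0 _ m0); lra.
apply: (@le_trans _ _ (252 * lam * \sum_(m <= j < n) 4 ^+ j * P j)); last first.
  have := ler_wpM2l (ltW lamp) (HP n); lra.
rewrite mulr_sumr; apply: ler_sum_nat => j /andP[mj _].
have yP : 4 ^+ j * P j <= 1 / 4096.
  apply: le_trans (HP j.+1); rewrite big_nat_recr //= lerDr sumr_ge0 // => i _.
  by rewrite mulr_ge0 // exprn_ge0.
have -> : (2 ^ j.+1)%N%:R ^+ 2 = 4 * 4 ^+ j :> R.
  rewrite natrX -exprM mulnC exprM exprS; congr (_ * _).
    by ring.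
  by congr (_ ^+ _); ring.
have ymy : 4 ^+ m <= 4 ^+ j :> R by rewrite ler_weXn2l // ler1n.
have yl : 1 / 20 <= 4 ^+ j * lam.
  by apply: le_trans lam0 _; rewrite ler_wpM2r // ltW.
have h1 : 0 <= P j * (1 / 4096 - 4 ^+ j * P j) by rewrite mulr_ge0 ?subr_ge0.
have h2 : 0 <= P j * (4 ^+ j * lam - 1 / 20) by rewrite mulr_ge0 ?subr_ge0.
have := P0 j; lra.
Qed.

(** Levels below [m] are bounded crudely, [m] equal terms made small by a large [n]. From [m] on,
    level [j] costs at most [84 * lam * 2^j / 2^n]; these sum geometrically to at most
    [84 / 1024 * lam], and stopping at [n - 10] is what gives the [1024]. *)
Lemma dirichlet_excluded_length (R : realType) (lam : R) (m n : nat) :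
  1 / 20 <= 4 ^+ m * lam -> (m + 10 <= n)%N ->
  m%:R * ((4 ^+ m * (lam / 2 + 2) + 1) * (2 / 2 ^+ n)) <= lam / 16 ->
  \sum_(0 <= j < n - 10) (((2 ^ j.+1)%N%:R ^+ 2 * (lam / 2 + 2 * (2 ^+ j * 2 ^+ n)^-1)
      + 1) * (2 * (2 ^+ j * 2 ^+ n)^-1)) <= lam / 16 + lam / 8.
Proof.
move=> lam0 mn Hm.
have m0 : (0 : R) < 4 ^+ m by rewrite exprn_gt0.
have lamp : 0 < lam by rewrite -(pmulr_rgt0 _ m0); lra.
have Q0 : (0 : R) < 2 ^+ n by rewrite exprn_gt0.
have sq j : (2 ^ j.+1)%N%:R ^+ 2 = 4 * 4 ^+ j :> R.
  by rewrite natrX -exprM mulnC exprM -exprS; congr (_ ^+ _); ring.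
rewrite (big_cat_nat (n := m)) //=; last by lia.
apply: lerD.
  apply: le_trans Hm.
  rewrite -[X in X%:R * _]subn0 mulr_natl -sumr_const_nat.
  apply: ler_sum_nat => j /andP[_ jm].
  have y1 : 1 <= 2 ^+ j :> R by rewrite exprn_ege1 // ler1n.
  have Q1 : 1 <= 2 ^+ n :> R by rewrite exprn_ege1 // ler1n.
  have yi : (2 ^+ j * 2 ^+ n)^-1 <= (2 ^+ n)^-1 :> R.
    by rewrite lef_pV2 ?posrE ?mulr_gt0 ?exprn_gt0 // ler_peMl // ltW.
  have qi : (2 ^+ n)^-1 <= 1 :> R by rewrite invf_le1.
  have i0 : 0 <= (2 ^+ j * 2 ^+ n)^-1 :> R by rewrite invr_ge0 mulr_ge0 // ltW // exprn_gt0.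
  apply: ler_pM; last by lra.
  - by rewrite addr_ge0 // mulr_ge0 ?exprn_ge0 //; lra.
  - by lra.
  - rewrite lerD2r; apply: ler_pM; [by rewrite exprn_ge0|by lra| |by lra].
    by rewrite sq -exprS ler_weXn2l // ler1n.
have S2 k : \sum_(0 <= j < k) 2 ^+ j <= 2 ^+ k :> R.
  elim: k => [|k IH]; first by rewrite big_geq.
  by rewrite big_nat_recr //= exprS; lra.
apply: (@le_trans _ _ (84 * lam / 2 ^+ n * \sum_(m <= j < n - 10) 2 ^+ j)); last first.
  apply: (@le_trans _ _ (84 * lam / 2 ^+ n * 2 ^+ (n - 10))).
    rewrite ler_pM2l ?divr_gt0 ?mulr_gt0 //; apply: le_trans (S2 (n - 10)%N).
    rewrite [leRHS](big_cat_nat (n := m)) //=; last by lia.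
    by rewrite lerDr sumr_ge0 // => j _; rewrite exprn_ge0.
  have -> : 2 ^+ n = 1024 * 2 ^+ (n - 10) :> R.
    rewrite (_ : 1024 = 2 ^+ 10 :> R); last by ring.
    by rewrite -exprD; congr (_ ^+ _); lia.
  have k0 : (0 : R) < 2 ^+ (n - 10) by rewrite exprn_gt0.
  rewrite [leLHS](_ : _ = 84 / 1024 * lam); last by field; rewrite gt_eqF.
  lra.
rewrite mulr_sumr; apply: ler_sum_nat => j /andP[mj jn].
have y0 : (0 : R) < 2 ^+ j by rewrite exprn_gt0.
have yQ : 1024 * 2 ^+ j <= 2 ^+ n :> R.
  rewrite (_ : 1024 = 2 ^+ 10 :> R); last by ring.
  by rewrite -exprD ler_weXn2l ?ler1n //; lia.
have y2 : 4 ^+ j = 2 ^+ j * 2 ^+ j :> R by rewrite -exprMn; congr (_ ^+ _); ring.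
have yl : 1 / 20 <= 2 ^+ j * 2 ^+ j * lam.
  apply: le_trans lam0 _; rewrite -y2 ler_wpM2r ?(ltW lamp) //.
  by rewrite ler_weXn2l // ler1n.
rewrite sq y2.
move: (2 ^+ j) (2 ^+ n) y0 Q0 yQ yl => y Q y0 Q0 yQ yl.
rewrite [leLHS](_ : _ = (4 * y * lam + 16 / Q + 2 / y) / Q); last first.
  by field; rewrite !gt_eqF.
rewrite [leRHS](_ : _ = 84 * lam * y / Q); last by field; rewrite gt_eqF.
rewrite ler_pM2r ?invr_gt0 //.
have h1 : 1024 * Q^-1 <= y^-1.
  rewrite -subr_ge0 (_ : _ - _ = (Q - 1024 * y) / (y * Q)); last first.
    by field; rewrite !gt_eqF.
  by rewrite divr_ge0 ?subr_ge0 // ltW // mulr_gt0.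
have h2 : y^-1 <= 20 * (y * lam).
  rewrite -(ler_pM2l y0) mulfV ?gt_eqF //; lra.
have := mulr_gt0 y0 lamp; lra.
Qed.

(* A ball is charged [1] if it is long compared with [eta], and the fraction of
   its [s]-mass in the budget [h] otherwise. *)
Definition ball_charge (R : realType) (U : pred nat) (w : nat -> R) (s eta h : R)
    (i : nat) : R :=
  if U i then if eta <= w i then 1 else w i `^ s / h else 0.

Lemma ball_charge_ge0 (R : realType) (U : pred nat) (w : nat -> R) (s eta h : R)
  (i : nat) : 0 < h -> 0 <= ball_charge U w s eta h i.
Proof.
move=> h0; rewrite /ball_charge; case: ifP => // _; case: ifP => // _.
by rewrite divr_ge0 ?powR_ge0 // ltW.
Qed.

(** The mass bound forces [w i <= D], hence [w i <= w i^s * D^(1 - s)]. A long ball costs at most a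
    multiple of [w i]; for a short one [w i + C * eta <= (1 + C) * eta]. Either way the cost is a
    multiple of [w i^s], and these sum to at most [D^s]. *)
Lemma ball_charge_length (R : realType) (U : pred nat) (w : nat -> R)
    (s eta h D C : R) (N : nat) :
  0 < s < 1 -> 0 < h -> 0 < D -> 0 < eta -> 0 <= C -> (forall i, 0 < w i) ->
  (forall N, \sum_(i < N | U i) w i `^ s <= D `^ s) ->
  \sum_(i < N) ball_charge U w s eta h i * (2 * (w i + C * eta)) <=
    2 * (1 + C) * (D + D `^ s * eta / h).
Proof.
move=> /andP[s0 s1] h0 D0 eta0 C0 w0 Uw.
have DD : D = D `^ s * D `^ (1 - s).
  by rewrite -powRD addrCA subrr addr0 ?oner_eq0 ?powRr1 // ltW.
have Ds : 0 < D `^ s by exact: powR_gt0.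
apply: (@le_trans _ _ (2 * (1 + C) * (D `^ (1 - s) + eta / h) *
    \sum_(i < N | U i) w i `^ s)); last first.
  rewrite {2}DD -mulrA; apply: ler_wpM2l; first by rewrite mulr_ge0 ?addr_ge0.
  rewrite [leLHS]mulrC -mulrA -mulrDr; apply: ler_wpM2r => //.
  by rewrite addr_ge0 ?powR_ge0 // divr_ge0 // ltW.
rewrite mulr_sumr [leRHS]big_mkcond; apply: ler_sum => i _.
rewrite /ball_charge; case: ifPn => [Ui|_]; last by rewrite mul0r.
have ws0 : 0 < w i `^ s by exact: powR_gt0.
have wD : w i <= D.
  rewrite leNgt; apply/negP => Dw.
  have : D `^ s < w i `^ s by apply: gt0_ltr_powR; rewrite ?nnegrE ?(ltW D0) ?(ltW (w0 i)).
  rewrite ltNge => /negP[]; apply: le_trans (Uw i.+1).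
  rewrite big_mkcond big_ord_recr /= Ui lerDr sumr_ge0 // => j _.
  by case: ifP => // _; exact: powR_ge0.
have ww : w i <= w i `^ s * D `^ (1 - s).
  have {1}-> : w i = w i `^ s * w i `^ (1 - s).
    by rewrite -powRD addrCA subrr addr0 ?oner_eq0 ?powRr1 // ltW.
  rewrite ler_pM2l //; apply: ge0_ler_powR; rewrite ?nnegrE ?subr_ge0 ?(ltW s1) //.
  - exact: ltW (w0 i).
  - exact: ltW.
have D1 : 0 <= D `^ (1 - s) by exact: powR_ge0.
have eh : 0 < eta / h by rewrite divr_gt0.
case: ifPn => [ew|]; last rewrite -ltNge => we.
  have h1 : 0 <= C * (w i - eta) by rewrite mulr_ge0 ?subr_ge0.
  have h2 : 0 <= (1 + C) * (w i `^ s * D `^ (1 - s) - w i).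
    by rewrite mulr_ge0 ?subr_ge0 ?addr_ge0.
  have h3 : 0 <= (1 + C) * (eta / h * w i `^ s).
    by rewrite mulr_ge0 ?addr_ge0 // mulr_ge0 // ltW.
  lra.
rewrite (_ : w i `^ s / h * _ = 2 * w i `^ s * ((w i + C * eta) / h)); last by ring.
have h4 : (w i + C * eta) / h <= (1 + C) * (eta / h).
  by rewrite mulrA ler_pM2r ?invr_gt0 //; lra.
have h5 : 0 <= w i `^ s * ((1 + C) * (eta / h) - (w i + C * eta) / h).
  by rewrite mulr_ge0 ?subr_ge0 // ltW.
have h6 : 0 <= (1 + C) * (w i `^ s * D `^ (1 - s)).
  by rewrite mulr_ge0 ?addr_ge0 // mulr_ge0 // ltW.
lra.
Qed.

(** The point is sought in the middle half of [[a, b]], of length [lam / 2], while the three kinds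
    of exclusion cost [lam / 16], [lam / 16 + lam / 8] and [lam / 8]. Balls are enlarged by
    [2^11 / 4^n], the distance from the point within which the next interval will lie. *)
Lemma exists_good_point (R : realType) (a b s h D : R) (P w c : nat -> R)
    (U : pred nat) (m n : nat) :
  a < b -> 1 / 20 <= 4 ^+ m * (b - a) -> (m + 10 <= n)%N ->
  m%:R * ((4 ^+ m * ((b - a) / 2 + 2) + 1) * (2 / 2 ^+ n)) <= (b - a) / 16 ->
  (forall j, 0 <= P j) -> (forall n, \sum_(m <= j < n) 4 ^+ j * P j <= 1 / 4096) ->
  0 < s < 1 -> 0 < h -> (forall i, 0 < w i) ->
  0 < D -> 1024 * (128 * D) <= b - a ->
  (forall N, \sum_(i < N | U i) w i `^ s <= D `^ s) ->
  1024 * (128 * (D `^ s * (4 ^+ n)^-1 / h)) <= b - a ->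
  exists x, [/\ a + (b - a) / 4 <= x <= b - (b - a) / 4,
    forall j, (m <= j < n)%N -> forall (r : int) t, (0 < t < 2 ^ j.+1)%N ->
      3 * P j < `|x - r%:~R / t%:R|,
    forall j, (j < n - 10)%N -> forall (r : int) t, (0 < t < 2 ^ j.+1)%N ->
      (2 ^+ j * 2 ^+ n)^-1 < `|x - r%:~R / t%:R| &
    forall N, \sum_(i < N | `|x - c i| <= w i + 2 ^+ 11 * (4 ^+ n)^-1)
      ball_charge U w s (4 ^+ n)^-1 h i < 1].
Proof.
move=> ab lam0 mn Hm P0 HP s01 h0 w0 D0 Dlam Uw Hh.
pose lam := b - a; have lamp : 0 < lam by rewrite subr_gt0.
pose eta : R := (4 ^+ n)^-1; have eta0 : 0 < eta by rewrite invr_gt0 exprn_gt0.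
pose ts := [seq ((2 ^ j.+1)%N, 3 * P j) | j <- index_iota m n] ++
  [seq ((2 ^ j.+1)%N, (2 ^+ j * 2 ^+ n)^-1 : R) | j <- index_iota 0 (n - 10)].
have [|||||||x [xab xts xU]] := @exists_avoid_rats R (a + lam / 4) (b - lam / 4)
    (lam / 16 + (lam / 16 + lam / 8)) (lam / 8) ts c
    (fun i => w i + 2 ^+ 11 * eta) (ball_charge U w s eta h).
- by move=> k; rewrite addr_ge0 ?mulr_ge0 ?exprn_ge0 ?ler0n ?(ltW eta0) ?(ltW (w0 k)).
- by move=> k; exact: ball_charge_ge0.
- move=> p; rewrite mem_cat => /orP[] /mapP[j _ ->] /=; rewrite expn_gt0; split => //.
    by rewrite mulr_ge0.
- rewrite /ts big_cat !big_map /=.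
  have -> : b - lam / 4 - (a + lam / 4) = lam / 2 by rewrite /lam; lra.
  apply: lerD; first exact: psi_excluded_length.
  exact: dirichlet_excluded_length Hm.
(* With [C = 2^11] the bound is at most [2 * (1 + 2^11) * 2 * lam / (1024 * 128)], which is below
   [lam / 8]. *)
- move=> N; apply: le_trans (ball_charge_length _ _ _ _ _ _ _ Uw) _ => //.
  have -> : 2 ^+ 11 = 32 * 64 :> R by ring.
  by rewrite -/eta in Hh; rewrite /lam; lra.
- by rewrite /lam; lra.
- by rewrite /lam; lra.
exists x; split => //.
- move=> j mjn r t /andP[t0 tT].
  by apply: (xts ((2 ^ j.+1)%N, 3 * P j)) => //; rewrite mem_cat map_f // mem_index_iota.
- move=> j jn r t /andP[t0 tT].
  apply: (xts ((2 ^ j.+1)%N, (2 ^+ j * 2 ^+ n)^-1)) => //.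
  by rewrite mem_cat [X in _ || X]map_f ?orbT // mem_index_iota.
Qed.

(** * Intervals next to a Dirichlet approximant *)

(** The lower inequality of [E] on a finite range of denominators, to be extended stage by stage. *)
Definition avoids (R : realType) (Psi omega : R -> R) (M N : nat) (x : R) :=
  forall t, (M <= t < N)%N -> forall r : int,
    (1 - omega t%:R) * Psi t%:R <= `|x - r%:~R / t%:R|.

(** The least admissible denominator is taken: an equal fraction with smaller [t] would satisfy the
    bound too, as [1 / (t * Q)] is larger. This replaces reduction to lowest terms. *)
Lemma minimal_dirichlet (R : realType) (x : R) (Q : nat) : (0 < Q)%N ->
  exists (p : int) (q : nat), [/\ (0 < q <= Q)%N,
    `|x - p%:~R / q%:R| <= (q%:R * Q%:R)^-1 &
    forall (r : int) t, (0 < t < q)%N -> r%:~R / t%:R <> p%:~R / q%:R :> R].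
Proof.
move=> Q0.
pose P q := `[< (0 < q <= Q)%N /\
  exists p : int, `|x - p%:~R / q%:R| <= (q%:R * Q%:R)^-1 >].
have exP : exists q, P q.
  have [p [q [q0 qQ h]]] := dirichlet x Q0.
  by exists q; apply/asboolP; rewrite q0 qQ; split => //; exists p.
case: (ex_minnP exP) => q /asboolP[/andP[q0 qQ] [p h]] qmin.
exists p, q; split => //; first by rewrite q0.
move=> r t /andP[t0 tq] E; have := tq; rewrite ltnNge => /negP[]; apply: qmin.
apply/asboolP; rewrite t0 (leq_trans (ltnW tq) qQ); split => //.
exists r; rewrite E; apply: le_trans h _.
by rewrite lef_pV2 ?posrE ?mulr_gt0 ?ltr0n // ler_pM2r ?ltr0n // ler_nat ltnW.
Qed.

(* Two rationals close to opposite thirds would be distinct and closer than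
   the separation [4^-m] allows. *)
Lemma third_avoiding_rationals (R : realType) (z L : R) (m : nat) :
  0 < L -> 4 ^+ m * L < 3 / 5 ->
  exists a b, [/\ z <= a, b <= z + L, b - a = L / 3 &
    forall x, a <= x <= b -> forall (r : int) t, (0 < t < 2 ^ m)%N ->
      L / 45 <= `|x - r%:~R / t%:R|].
Proof.
move=> L0 mL.
pose bad a b := exists x (r : int) (t : nat), [/\ a <= x <= b, (0 < t < 2 ^ m)%N &
  `|x - r%:~R / t%:R| < L / 45].
have good a b : b - a = L / 3 -> z <= a -> b <= z + L -> ~ bad a b ->
  exists a b, [/\ z <= a, b <= z + L, b - a = L / 3 &
    forall x, a <= x <= b -> forall (r : int) t, (0 < t < 2 ^ m)%N ->
      L / 45 <= `|x - r%:~R / t%:R|].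
  move=> ba za bz nb; exists a, b; split => // x xab r t tm.
  by rewrite leNgt; apply/negP => h; apply: nb; exists x, r, t.
have [b1|] := pselect (bad z (z + L / 3)); last by apply: good; lra.
have [b2|] := pselect (bad (z + L * (2 / 3)) (z + L)); last by apply: good; lra.
exfalso.
have [x [r [t [/andP[x1 x2] /andP[t0 tm] xr]]]] := b1.
have [x' [r' [t' [/andP[x'1 x'2] /andP[t'0 t'm] xr']]]] := b2.
move: xr xr'; rewrite !ltr_norml => /andP[h1 h2] /andP[h3 h4].
have neq : r%:~R / t%:R != r'%:~R / t'%:R :> R.
  by apply/eqP => E; rewrite E in h1 h2; lra.
have := rat_dist_ge t0 t'0 neq; rewrite leNgt => /negP[].
have tt : (t%:R * t'%:R : R) <= 4 ^+ m.
  have -> : 4 ^+ m = 2 ^+ m * 2 ^+ m :> R by rewrite -exprMn; congr (_ ^+ _); ring.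
  by rewrite -natrX ler_pM // ler_nat ltnW.
have m0 : (0 : R) < 4 ^+ m by rewrite exprn_gt0.
(* Distinct rationals are thus more than [5/3 * L] apart, whereas these two are within
   [L + 2 * L / 45]. *)
have i : 5 / 3 * L < (t%:R * t'%:R)^-1.
  apply: (@lt_le_trans _ _ (4 ^+ m)^-1).
    by rewrite -(ltr_pM2l m0) mulfV ?gt_eqF //; lra.
  by rewrite lef_pV2 ?posrE ?mulr_gt0 // ltr0n.
apply: lt_trans i; rewrite ltr_norml; apply/andP; split; lra.
Qed.

(** The least [m] reaching [3/20] overshoots by a factor below [4]. The bound [3/5] is what
    [third_avoiding_rationals] requires, and [3/20] leaves [1/20] for a third of [L]. *)
Lemma exists_scale (R : realType) (L : R) : 0 < L <= 3 / 20 ->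
  exists m, 3 / 20 <= 4 ^+ m * L < 3 / 5.
Proof.
move=> /andP[L0 L1].
have exP : exists m, 3 / 20 <= 4 ^+ m * L.
  exists (Num.trunc L^-1).+1.
  apply: (@le_trans _ _ 1); first lra.
  rewrite -ler_pdivrMr // mul1r; apply: le_trans (ltW (truncnS_gt _)) _.
  by rewrite -natrX ler_nat ltnW // ltn_expl.
case: (ex_minnP exP) => -[|m] h hmin; first by exists 0%N; rewrite h expr0; lra.
exists m.+1; rewrite h exprS /=.
have : 4 ^+ m * L < 3 / 20.
  by rewrite ltNge; apply/negP => /hmin; rewrite ltnn.
lra.
Qed.

(** Cases on [r / t]: equal to [p / q]; distinct with [t < q], where [x] is known to be far from
    [r / t]; distinct with [q <= t <= 1 / (2 * q * Psi q)], where separation from [p / q] suffices;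
    larger [t], left to the lower bound on [omega]. *)
Lemma approx_margin (R : realType) (Psi omega : R -> R) (p : int) (q : nat)
    (x : R) (m m' n : nat) (y : R)
  (Psi_gt0 : forall q : R, 0 < q -> 0 < Psi q)
  (omega_itv : forall q : R, 0 < q -> 0 < omega q < 1)
  (Psi_noninc : forall q r : R, 0 < q -> q <= r ->
    r ^+ 2 * Psi r <= q ^+ 2 * Psi q) :
  4 ^+ m * Psi (2 ^+ m) <= 1 / 4096 ->
  (2 ^ m <= q <= 2 ^ n)%N ->
  `|x - p%:~R / q%:R| <= (q%:R * (2 ^ n)%N%:R)^-1 ->
  (forall (r : int) t, (0 < t < q)%N -> r%:~R / t%:R <> p%:~R / q%:R :> R) ->
  (forall j, (m <= j < n)%N -> forall (r : int) t, (0 < t < 2 ^ j.+1)%N ->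
      3 * Psi (2 ^+ j) < `|x - r%:~R / t%:R|) ->
  omega q%:R <= 1 / 2 ->
  omega q%:R >= 45 / Psi q%:R * Psi (1 / (2 * q%:R * Psi q%:R)) ->
  (1 - omega q%:R) * Psi q%:R <= `|y - p%:~R / q%:R| <= Psi q%:R ->
  (forall (r : int) t, (0 < t < 2 ^ m')%N ->
     omega q%:R * Psi q%:R / 45 <= `|y - r%:~R / t%:R|) ->
  avoids Psi omega (2 ^ m) (2 ^ m') y.
Proof.
move=> psim /andP[mq qn] xp pmin xj om2 om45 /andP[yp1 yp2] y45 t /andP[mt tm'] r.
have Psi_le q1 q2 : 0 < q1 -> q1 <= q2 -> Psi q2 <= Psi q1.
  move=> q10 q12; have q20 := lt_le_trans q10 q12.
  rewrite -(@ler_pM2l _ (q1 ^+ 2)) ?exprn_gt0 //.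
  apply: le_trans (Psi_noninc _ _ q10 q12); rewrite ler_wpM2r ?(ltW (Psi_gt0 _ _)) //.
  by rewrite ler_sqr ?nnegrE ?(ltW q10) ?(ltW q20).
have two0 : (0 : R) < 2 ^+ m by rewrite exprn_gt0.
have q0 : (0 < q)%N by apply: leq_trans mq; rewrite expn_gt0.
have t0 : (0 < t)%N by apply: leq_trans mt; rewrite expn_gt0.
have qR : (0 : R) < q%:R by rewrite ltr0n.
have tR : (0 : R) < t%:R by rewrite ltr0n.
have psi_le z : (2 ^ m <= z)%N -> z%:R ^+ 2 * Psi z%:R <= 1 / 4096.
  move=> mz; apply: le_trans psim; apply: le_trans (Psi_noninc _ _ two0 _) _.
    by rewrite -natrX ler_nat.
  by rewrite -exprM mulnC exprM (_ : 2 ^+ 2 = 4) //; ring.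
have Pq := Psi_gt0 _ qR; have Pt := Psi_gt0 _ tR.
have /andP[ot0 ot1] := omega_itv _ tR.
have Pt1 : (1 - omega t%:R) * Psi t%:R <= Psi t%:R 
  by rewrite ler_piMl ?(ltW Pt) // lerBlDr lerDl ltW.
have ti0 : 0 < (t%:R * q%:R)^-1 :> R by rewrite invr_gt0 mulr_gt0.
have inv_le (k : R) z : 0 < z -> k * (z * z) <= 1 -> k <= (z * z)^-1.
  by move=> z0 h; rewrite -(@ler_pM2r _ (z * z)) ?mulr_gt0 // mulVf // gt_eqF ?mulr_gt0.
have [uv|/eqP uv] := eqVneq (r%:~R / t%:R : R) (p%:~R / q%:R).
  rewrite uv; apply: le_trans yp1.
  have [tq|qt|->//] := ltngtP t q.
    by case: (@pmin r t) => //; rewrite t0.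
  (* For [q < t < 2 * q] the fraction [(r - p) / (t - q)] equals [p / q] with a smaller denominator.
     For [t >= 2 * q] monotonicity gives [Psi t <= Psi q / 4], and [omega q <= 1/2] concludes. *)
  have [tq2|q2t] := ltnP t (2 * q).
    have tqR : (0 : R) < (t - q)%:R by rewrite ltr0n subn_gt0.
    case: (@pmin (r - p) (t - q)%N).
      by rewrite subn_gt0 qt -(ltn_add2r q) subnK ?(ltnW qt) // addnn -mul2n.
    have rE : r%:~R = p%:~R / q%:R * t%:R :> R by rewrite -uv divfK // gt_eqF.
    have tE : t%:R = (t - q)%:R + q%:R :> R by rewrite -natrD subnK // ltnW.
    by rewrite rmorphB /= rE tE; field; rewrite !gt_eqF.
  have q2tR : 2 * q%:R <= t%:R :> R by rewrite -natrM ler_nat.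
  have := Psi_noninc _ _ qR (le_trans (ler_peMl (ltW qR) (ler1n _ 2)) q2tR).
  have : (2 * q%:R) ^+ 2 * Psi t%:R <= t%:R ^+ 2 * Psi t%:R.
    by rewrite ler_wpM2r ?(ltW Pt) // ler_sqr ?nnegrE ?mulr_ge0 // ltW.
  move=> h1 h2; have {h1 h2} := le_trans h1 h2.
  rewrite exprMn -mulrA mulrCA ler_pM2l ?exprn_gt0 // => h4.
  have : 0 <= (1 / 2 - omega q%:R) * Psi q%:R by rewrite mulr_ge0 ?subr_ge0 // ltW.
  lra.
apply: le_trans Pt1 _.
have D : (t%:R * q%:R)^-1 <= `|r%:~R / t%:R - p%:~R / q%:R| :> R.
  by apply: rat_dist_ge => //; exact/eqP.
have T2 := ler_distD y (r%:~R / t%:R) (p%:~R / q%:R); rewrite [X in _ <= X + _]distrC in T2.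
have [tq|qt] := ltnP t q.
  have /andP[jt tj] := @trunc_log_bounds 2 t isT t0.
  move: (trunc_log 2 t) jt tj => j jt tj.
  have mj : (m <= j)%N by rewrite -ltnS -(@ltn_exp2l 2) // (leq_ltn_trans mt).
  have jn : (j < n)%N by rewrite -(@ltn_exp2l 2) // (leq_ltn_trans jt) // (leq_trans tq).
  have h3 : 3 * Psi (2 ^+ j) < `|x - r%:~R / t%:R|.
    by apply: xj; rewrite ?mj ?jn ?t0 ?tj.
  have Pj : Psi t%:R <= Psi (2 ^+ j).
    by apply: Psi_le; rewrite ?exprn_gt0 // -natrX ler_nat.
  (* Let [d] be the distance of [r / t] from [p / q]. As [|x - p / q| <= 1 / (t * q) <= d], one has
     [3 * Psi t < 2 * d]; moreover [Psi q <= d / 4], so [y] keeps distance [3 * d / 4 > Psi t]. *)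
  have T1 := ler_distD (p%:~R / q%:R) x (r%:~R / t%:R); rewrite [X in _ <= _ + X]distrC in T1.
  have i1 : (q%:R * (2 ^ n)%N%:R)^-1 <= (t%:R * q%:R)^-1 :> R.
    rewrite lef_pV2 ?posrE ?mulr_gt0 ?ltr0n ?expn_gt0 // mulrC ler_pM2l //.
    by rewrite ler_nat (leq_trans (ltnW tq)).
  have Pq4 : 4 * Psi q%:R <= (t%:R * q%:R)^-1.
    apply: (@le_trans _ _ (q%:R * q%:R)^-1); last first.
      by rewrite lef_pV2 ?posrE ?mulr_gt0 // ler_pM2r // ler_nat ltnW.
    by apply: inv_le => //; have := psi_le _ mq; lra.
  lra.
have Pt2 : 2 * Psi t%:R <= (t%:R * q%:R)^-1.
  apply: (@le_trans _ _ (t%:R * t%:R)^-1); last first.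
    by rewrite lef_pV2 ?posrE ?mulr_gt0 // ler_pM2l // ler_nat.
  by apply: inv_le => //; have := psi_le _ mt; lra.
(* Below the threshold, [Psi q] and [Psi t] are each at most half of [1 / (t * q)], so their sum
   fits in the gap between the rationals. *)
have [tbig|tsmall] := leP (t%:R) (1 / (2 * q%:R * Psi q%:R)).
  have : 2 * Psi q%:R <= (t%:R * q%:R)^-1.
    rewrite -(@ler_pM2r _ (t%:R * q%:R)) ?mulr_gt0 // mulVf ?gt_eqF ?mulr_gt0 //.
    by move: tbig; rewrite ler_pdivlMr ?mulr_gt0 //; lra.
  lra.
apply: le_trans (y45 r t _); last by rewrite t0.
have : Psi t%:R <= Psi (1 / (2 * q%:R * Psi q%:R)).
  by apply: Psi_le (ltW tsmall); rewrite divr_gt0 ?mulr_gt0.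
move: om45; rewrite mulrAC ler_pdivrMr //; lra.
Qed.

(** * The nested intervals *)

(** Invariant of a stage. [state_mass] counts exactly the balls meeting [[a, b]]; in particular each
    of them has radius at most [(b - a) / 1024 / 128]. *)
Record construction_state (R : realType) (Psi omega : R -> R) (c w : nat -> R)
    (s : R) (m0 : nat) (a b : R) (m : nat) : Prop := ConstructionState {
  state_lt : a < b;
  state_m0 : (m0 <= m)%N;
  state_scale : 1 / 20 <= 4 ^+ m * (b - a);
  state_avoids : forall x, a <= x <= b -> avoids Psi omega (2 ^ m0) (2 ^ m) x;
  state_mass : forall N, \sum_(i < N | a - w i <= c i <= b + w i) w i `^ s <=
    ((b - a) / 1024 / 128) `^ s }.

Lemma exists_large_scale (R : realType) (A : R) :
  exists N, forall n, (N <= n)%N -> A <= 2 ^+ n.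
Proof.
exists (Num.trunc A).+1 => n Nn; apply: le_trans (ltW (truncnS_gt _)) _.
by rewrite -natrX ler_nat (leq_trans Nn) // ltnW // ltn_expl.
Qed.

(** If [2^j <= q < 2^(j+1)] with [j < k], then [p / q] itself is one of the rationals kept away at
    level [j], yet [1 / (q * 2^n)] is at most the radius there. *)
Lemma dyadic_avoid_denominator (R : realType) (x : R) (p : int) (q k n : nat) :
  (0 < q)%N -> `|x - p%:~R / q%:R| <= (q%:R * (2 ^ n)%N%:R)^-1 ->
  (forall j, (j < k)%N -> forall (r : int) t, (0 < t < 2 ^ j.+1)%N ->
     (2 ^+ j * 2 ^+ n)^-1 < `|x - r%:~R / t%:R|) ->
  (2 ^ k <= q)%N.
Proof.
move=> q0 xp H; rewrite leqNgt; apply/negP => qk.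
have /andP[jq qj] := @trunc_log_bounds 2 q isT q0.
move: (trunc_log 2 q) jq qj => j jq qj.
have jk : (j < k)%N by rewrite -(@ltn_exp2l 2) // (leq_ltn_trans jq).
have := H j jk p q; rewrite q0 qj => /(_ isT); rewrite ltNge => /negP[].
apply: le_trans xp _; rewrite natrX.
by rewrite lef_pV2 ?posrE ?mulr_gt0 ?exprn_gt0 ?ltr0n // ler_pM2r ?exprn_gt0 // -natrX ler_nat.
Qed.

(** Total charge below [1] rules out balls of charge [1]; each remaining ball of [V] has charge
    [w i^s / h], so the masses sum to at most [h]. *)
Lemma charge_lt1_mass_le (R : realType) (U V : pred nat) (w c : nat -> R)
    (s eta h x C : R) :
  0 < h -> (forall i, 0 < w i) ->
  (forall N, \sum_(i < N | `|x - c i| <= w i + C) ball_charge U w s eta h i < 1) ->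
  (forall i, V i -> U i /\ `|x - c i| <= w i + C) ->
  forall N, \sum_(i < N | V i) w i `^ s <= h.
Proof.
move=> h0 w0 lt1 VU N.
have ch0 i : 0 <= ball_charge U w s eta h i by exact: ball_charge_ge0.
have small i : V i -> w i `^ s = h * ball_charge U w s eta h i.
  move=> Vi; have [Ui xi] := VU i Vi.
  have : ball_charge U w s eta h i < 1.
    apply: le_lt_trans (lt1 i.+1).
    by rewrite big_mkcond big_ord_recr /= xi lerDr sumr_ge0 // => j _; case: ifP.
  rewrite /ball_charge Ui; case: ifP => [_|_ _]; first by rewrite ltxx.
  by rewrite mulrC divfK // gt_eqF.
rewrite -[leRHS]mulr1.
apply: (@le_trans _ _ (h * \sum_(i < N | `|x - c i| <= w i + C) ball_charge U w s eta h i)).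
  rewrite mulr_sumr big_mkcond [leRHS]big_mkcond; apply: ler_sum => i _.
  case: ifP => Vi; first by have [_ ->] := VU i Vi; rewrite small.
  by case: ifP => // _; rewrite mulr_ge0 // ltW.
by rewrite ler_wpM2l ?(ltW h0) // ltW.
Qed.

Lemma construction_step (R : realType) (Psi omega : R -> R) (c w : nat -> R)
    (s : R) (m0 : nat)
  (Psi_gt0 : forall q : R, 0 < q -> 0 < Psi q)
  (omega_itv : forall q : R, 0 < q -> 0 < omega q < 1)
  (Psi_noninc : forall q r : R, 0 < q -> q <= r ->
    r ^+ 2 * Psi r <= q ^+ 2 * Psi q)
  (g_noninc : forall q r : nat, (0 < q)%N -> (q <= r)%N ->
    Psi r%:R * omega r%:R <= Psi q%:R * omega q%:R)
  (tail_small : forall m n, (m0 <= m)%N ->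
    \sum_(m <= j < n) 4 ^+ j * Psi (2 ^+ j) <= 1 / 4096)
  (omega_small : forall q : R, 2 ^+ m0 <= q -> omega q <= 1 / 2)
  (omega_lb : forall q : R, 2 ^+ m0 <= q ->
    omega q >= 45 / Psi q * Psi (1 / (2 * q * Psi q)))
  (s01 : 0 < s < 1)
  (unbounded : forall M N, exists2 n, (N <= n)%N &
    M < 4 ^+ n * (Psi (2 ^ n)%N%:R * omega (2 ^ n)%N%:R) `^ s)
  (w_gt0 : forall i, 0 < w i) (a b : R) (m : nat) :
  construction_state Psi omega c w s m0 a b m ->
  exists a' b' m', [/\ construction_state Psi omega c w s m0 a' b' m',
    a <= a' /\ b' <= b, (m < m')%N, b' - a' <= (2 ^+ m)^-1 &
    exists (p : int) (q : nat), (2 ^ m <= q)%N /\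
      forall x, a' <= x <= b' -> `|x - p%:~R / q%:R| <= Psi q%:R].
Proof.
case=> ab m0m scale avd mass.
pose lam := b - a; have lam0 : 0 < lam by rewrite subr_gt0.
have [s0 s1] := andP s01.
pose D := lam / 1024 / 128; have D0 : 0 < D by rewrite !divr_gt0 ?ltr0n.
pose K := m%:R * ((4 ^+ m * (lam / 2 + 2) + 1)).
(* The next interval has length [L / 3], so its mass allowance will be [(e * L)^s]. *)
pose e := (3^-1 / 1024 / 128 : R).
have e0 : 0 < e by rewrite !divr_gt0 ?invr_gt0 ?ltr0n.
have [N1 HN1] := exists_large_scale (32 * K / lam).
have [N2 HN2] := exists_large_scale (4 * 2 ^+ 11 / lam).
(* The threshold is the one that makes [cond3] hold; [N1] and [N2] serve [cond1] and [cond2]. *)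
have [n Nn big] := unbounded (1024 * 128 * D `^ s / (e `^ s * lam)) (m + 10 + N1 + N2)%N.
have mn : (m + 10 <= n)%N by apply: leq_trans Nn; rewrite -addnA leq_addr.
have {}HN1 : 32 * K / lam <= 2 ^+ n.
  by apply: HN1; apply: leq_trans Nn; rewrite -addnA addnCA leq_addr.
have {}HN2 : 4 * 2 ^+ 11 / lam <= 2 ^+ n.
  by apply: HN2; apply: leq_trans Nn; rewrite leq_addl.
have Q0 : (0 : R) < 2 ^+ n by rewrite exprn_gt0.
have Q1 : (1 : R) <= 2 ^+ n by rewrite exprn_ege1 // ler1n.
have Q4 : 4 ^+ n = 2 ^+ n * 2 ^+ n :> R by rewrite -exprMn; congr (_ ^+ _); ring.
pose G : R := Psi (2 ^ n)%N%:R * omega (2 ^ n)%N%:R.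
have NQ0 : (0 : R) < (2 ^ n)%N%:R by rewrite ltr0n expn_gt0.
have G0 : 0 < G by rewrite mulr_gt0 ?Psi_gt0 //; have /andP[] := omega_itv _ NQ0.
(* The budget must be fixed before [q] is known; [q <= 2^n] will give [G <= L], so [h] fits the next
   allowance. *)
pose h := (e * G) `^ s; have h0 : 0 < h by rewrite powR_gt0 // mulr_gt0.
have cond1 : m%:R * ((4 ^+ m * ((b - a) / 2 + 2) + 1) * (2 / 2 ^+ n)) <= (b - a) / 16.
  rewrite -/lam (_ : _ * _ = 2 * K / 2 ^+ n); last by rewrite /K; ring.
  rewrite ler_pdivrMr //; move: HN1; rewrite ler_pdivrMr //; lra.
have cond2 : 2 ^+ 11 * (4 ^+ n)^-1 <= lam / 4.
  rewrite ler_pdivrMr ?exprn_gt0 // Q4.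
  move: HN2; rewrite ler_pdivrMr // => h1.
  have : 0 <= lam * (2 ^+ n * (2 ^+ n - 1)) by rewrite !mulr_ge0 ?subr_ge0 // ltW.
  lra.
have cond3 : 1024 * (128 * (D `^ s * (4 ^+ n)^-1 / h)) <= b - a.
  have es0 : 0 < e `^ s by exact: powR_gt0.
  have Gs0 : 0 < G `^ s by exact: powR_gt0.
  move: big; rewrite -/G ltr_pdivrMr ?mulr_gt0 // => /ltW big.
  rewrite /h powRM ?(ltW e0) ?(ltW G0) //.
  have F0 : (0 : R) < 4 ^+ n by rewrite exprn_gt0.
  rewrite (_ : 1024 * _ = 1024 * 128 * D `^ s / (4 ^+ n * (e `^ s * G `^ s))); last first.
    by field; rewrite !gt_eqF.
  rewrite ler_pdivrMr ?mulr_gt0 //; apply: le_trans big _.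
  by rewrite le_eqVlt; apply/orP; left; apply/eqP; rewrite /lam; ring.
have cond4 : 1024 * (128 * D) <= b - a by rewrite /D /lam; lra.
have P0 j : 0 <= Psi (2 ^+ j) by rewrite ltW // Psi_gt0 // exprn_gt0.
have [x [xab xpsi xdir xch]] := @exists_good_point R a b s h D (fun j => Psi (2 ^+ j))
  w c (fun i => a - w i <= c i <= b + w i) m n ab scale mn cond1 P0
  (fun n => tail_small m n m0m) s01 h0 w_gt0 D0 cond4 mass cond3.
have NQ : (0 < 2 ^ n)%N by rewrite expn_gt0.
have [p [q [/andP[q0 qQ] xp pmin]]] := minimal_dirichlet x NQ.
have kq := dyadic_avoid_denominator q0 xp xdir.
have mn10 : (m <= n - 10)%N.
  by rewrite -(leq_add2r 10) subnK // (leq_trans (leq_addl _ _) mn).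
have mq : (2 ^ m <= q)%N by apply: leq_trans kq; exact: leq_pexp2l.
clear cond1 cond3 cond4 big HN1 HN2 Nn xdir K N1 N2.
have qR : (0 : R) < q%:R by rewrite ltr0n.
have two0 : (0 : R) < 2 ^+ m by rewrite exprn_gt0.
have two_mq : 2 ^+ m <= q%:R :> R by rewrite -natrX ler_nat.
have m0q : 2 ^+ m0 <= q%:R :> R by apply: le_trans two_mq; rewrite ler_weXn2l ?ler1n.
have /andP[om0 om1] := omega_itv _ qR.
have Pq := Psi_gt0 _ qR.
pose L := omega q%:R * Psi q%:R.
have L0 : 0 < L by rewrite mulr_gt0.
have LP : L <= Psi q%:R by rewrite ler_piMl // ltW.
have psim : 4 ^+ m * Psi (2 ^+ m) <= 1 / 4096.
  by apply: le_trans (tail_small m m.+1 m0m); rewrite big_nat1.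
have F0 : (0 : R) < 4 ^+ m by rewrite exprn_gt0.
have F4 : 4 ^+ m = 2 ^+ m * 2 ^+ m :> R by rewrite -exprMn; congr (_ ^+ _); ring.
have psiq : q%:R * q%:R * Psi q%:R <= 1 / 4096.
  apply: le_trans psim; rewrite -expr2; apply: le_trans (Psi_noninc _ _ two0 two_mq) _.
  by rewrite expr2 F4.
have FP : 4 ^+ m * Psi q%:R <= 1 / 4096.
  apply: le_trans psiq; rewrite ler_pM2r // F4.
  by apply: ler_pM => //; exact: ltW.
have F1 : 1 <= 4 ^+ m :> R by rewrite exprn_ege1 // ler1n.
have FL : 4 ^+ m * L <= 1 / 4096 by apply: le_trans FP; rewrite ler_pM2l.
have P1 : Psi q%:R <= 1 / 4096 by apply: le_trans FP; rewrite ler_peMl // ltW.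
have Lsmall : 0 < L <= 3 / 20 by rewrite L0 /=; move: LP P1; clear; lra.
have [m' /andP[m'1 m'2]] := exists_scale Lsmall.
have mm' : (m < m')%N.
  rewrite ltnNge; apply/negP => m'm.
  have : 4 ^+ m' * L <= 4 ^+ m * L by rewrite ler_pM2r // ler_weXn2l // ler1n.
  by move: FL m'1; clear; lra.
pose z := p%:~R / q%:R + (1 - omega q%:R) * Psi q%:R.
have zL : z + L = p%:~R / q%:R + Psi q%:R by rewrite /z /L; ring.
have [a' [b' [za zb ab' far]]] := third_avoiding_rationals z L0 m'2.
have near y : a' <= y <= b' ->
    (1 - omega q%:R) * Psi q%:R <= `|y - p%:~R / q%:R| <= Psi q%:R.
  move=> /andP[ya yb].
  have y1 : (1 - omega q%:R) * Psi q%:R <= y - p%:~R / q%:R.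
    by rewrite lerBrDl (le_trans za).
  have y2 : y - p%:~R / q%:R <= Psi q%:R.
    by rewrite lerBlDl -zL (le_trans yb).
  rewrite ger0_norm ?y1 ?y2 //; apply: le_trans y1.
  by rewrite mulr_ge0 ?subr_ge0 // ltW.
(* Both points are within [2^10 / 4^n] of [p / q], because [2^n <= 2^10 * q] and
   [q^2 * Psi q <= 1 / 4096]. *)
have yx y : a' <= y <= b' -> `|x - y| <= 2 ^+ 11 * (4 ^+ n)^-1.
  move=> yab; have /andP[_ yp] := near y yab.
  have T := ler_distD (p%:~R / q%:R) x y; rewrite [X in _ <= _ + X]distrC in T.
  have n10 : 2 ^+ n = 2 ^+ 10 * 2 ^+ (n - 10) :> R.
    by rewrite -exprD subnKC // (leq_trans (leq_addl _ _) mn).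
  have kqR : 2 ^+ (n - 10) <= q%:R :> R by rewrite -natrX ler_nat.
  have k0 : (0 : R) < 2 ^+ (n - 10) by rewrite exprn_gt0.
  have nq : 2 ^+ n <= 2 ^+ 10 * q%:R :> R by rewrite n10 ler_pM2l ?exprn_gt0.
  have i1 : (q%:R * (2 ^ n)%N%:R)^-1 <= 2 ^+ 10 / 4 ^+ n :> R.
    rewrite natrX Q4 ler_pdivlMr ?mulr_gt0 // mulrC ler_pdivrMr ?mulr_gt0 //.
    by rewrite mulrA ler_pM2r.
  have i2 : Psi q%:R <= 2 ^+ 10 / 4 ^+ n.
    rewrite Q4 ler_pdivlMr ?mulr_gt0 //.
    apply: (@le_trans _ _ (Psi q%:R * ((2 ^+ 10 * q%:R) * (2 ^+ 10 * q%:R)))).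
      by rewrite ler_pM2l //; apply: ler_pM => //; exact: ltW.
    rewrite (_ : _ * _ = 2 ^+ 10 * 2 ^+ 10 * (q%:R * q%:R * Psi q%:R)); last by ring.
    apply: (@le_trans _ _ (2 ^+ 10 * 2 ^+ 10 * (1 / 4096))).
      by rewrite ler_pM2l ?mulr_gt0 ?exprn_gt0.
    have -> : 2 ^+ 10 = 1024 :> R by ring.
    by clear; lra.
  have -> : 2 ^+ 11 * (4 ^+ n)^-1 = 2 ^+ 10 / 4 ^+ n + 2 ^+ 10 / 4 ^+ n :> R.
    by rewrite exprS; ring.
  by apply: le_trans T _; apply: lerD; [exact: le_trans xp i1|exact: le_trans yp i2].
have ltab' : a' < b' by rewrite -subr_gt0 ab' divr_gt0.
have [/andP[xa xb]] := xab.
have aa' : a <= a'.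
  have := yx a'; rewrite lexx (ltW ltab') => /(_ isT) /le_trans /(_ cond2).
  by rewrite ler_norml => /andP[_ h2]; move: h2 xa; rewrite -/lam; clear; lra.
have bb' : b' <= b.
  have := yx b'; rewrite lexx (ltW ltab') => /(_ isT) /le_trans /(_ cond2).
  by rewrite ler_norml => /andP[h2 _]; move: h2 xb; rewrite -/lam; clear; lra.
have sc' : 1 / 20 <= 4 ^+ m' * (b' - a') by rewrite ab'; move: m'1; clear; lra.
exists a', b', m'; split => //; last 2 first.
- rewrite ab'; apply: (@le_trans _ _ (Psi q%:R)); first by move: LP L0; clear; lra.
  rewrite -(ler_pM2l two0) mulfV ?gt_eqF //.
  apply: (@le_trans _ _ (4 ^+ m * Psi q%:R)); last by move: FP; clear; lra.
  by rewrite ler_pM2r // F4 ler_peMl ?(ltW two0) // exprn_ege1 // ler1n.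
- by exists p, q; split => // y /near /andP[].
split => //.
- by rewrite (leq_trans m0m) // ltnW.
- move=> y yab t /andP[m0t tm'] r.
  have [tm|mt] := ltnP t (2 ^ m).
    apply: avd; last by rewrite m0t.
    by have /andP[y1 y2] := yab; rewrite (le_trans aa' y1) (le_trans y2 bb').
  apply: (@approx_margin R Psi omega p q x m m' n y) => //.
  + by rewrite mq.
  + exact: omega_small.
  + exact: omega_lb.
  + exact: near.
  + by move=> r' t' t'm; apply: far.
  + by rewrite mt.
have hL : h <= ((b' - a') / 1024 / 128) `^ s.
  have GL : G <= L by rewrite /L mulrC; exact: g_noninc.
  rewrite ab' /h (_ : L / 3 / 1024 / 128 = e * L); last by rewrite /e; ring.
  have eG : 0 <= e * G by rewrite ltW // mulr_gt0.
  have eL : 0 <= e * L by rewrite ltW // mulr_gt0.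
  by apply: ge0_ler_powR; rewrite ?nnegrE ?(ltW s0) ?eG ?eL ?(ler_pM2l e0) ?GL.
move=> N; apply: le_trans hL.
apply: (charge_lt1_mass_le (V := fun i => a' - w i <= c i <= b' + w i) h0 w_gt0 xch).
move=> i /andP[c1 c2]; split.
  by apply/andP; split; move: c1 c2 aa' bb'; clear; lra.
(* The point of [[a', b']] closest to [c i]: a ball meeting the new interval comes within
   [w i + 2^11 / 4^n] of [x]. *)
pose y := Num.max a' (Num.min b' (c i)).
have yab : a' <= y <= b'.
  by rewrite /y le_max lexx /= ge_max (ltW ltab') ge_min lexx.
apply: le_trans (ler_distD y _ _) _; rewrite addrC; apply: lerD; last exact: yx.
have wi := w_gt0 i.
rewrite /y /Num.max /Num.min; case: (ltP b' (c i)) => h1; case: ltP => h2;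
  rewrite ler_norml; apply/andP; move: c1 c2 h1 h2 ltab' wi; clear;
  move=> ? ? ? ? ? ?; split; lra.
Qed.

(** * From null sets to balls, the limit point and the conclusion *)

Lemma geometric_budget (R : realType) (c : R) (N : nat) : 0 <= c ->
  \sum_(i < N) c / 2 ^+ i.+1 <= c.
Proof.
move=> c0; suff -> : \sum_(i < N) c / 2 ^+ i.+1 = c - c / 2 ^+ N.
  by rewrite gerBl divr_ge0 ?exprn_ge0.
elim: N => [|N IH]; first by rewrite big_ord0 expr0 divr1 subrr.
rewrite big_ord_recr /= IH exprS; field.
by rewrite expf_neq0.
Qed.

Lemma hausdorff_null_balls (R : realType) (s s1 T : R) (A : set R) :
  0 <= s <= s1 -> 0 < s1 -> 0 < T -> hausdorff_measure s A = 0%E ->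
  exists c w : nat -> R, [/\ forall i, 0 < w i,
    forall x, A x -> exists i, `|x - c i| <= w i &
    forall N, \sum_(i < N) w i `^ s1 <= T].
Proof.
move=> ss1 s10 T0 /hausdorff_measure_eq0P H.
have T20 : 0 < T / 2 by rewrite divr_gt0.
have [F [[cov dF] sF]] := H 1 (T / 2) ltr01 T20.
pose di i := if pselect (F i !=set0) then fine (diameter (F i)) else 0.
pose c i := xget 0 (F i).
have di0 i : 0 <= di i.
  rewrite /di; case: pselect => // -[x Fx]; apply: fine_ge0.
  by have := le_diameter Fx Fx; rewrite subrr normr0.
have dig i : ((di i `^ s1)%:E <= hausdorff_gauge s (F i))%E.
  rewrite /di; case: pselect => F0; first exact: diameter_powR_le_gauge.
  by rewrite powR0 ?gt_eqF // hausdorff_gauge_ge0.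
have dis N : \sum_(i < N) di i `^ s1 <= T / 2.
  rewrite -lee_fin; apply: le_trans sF.
  apply: (@le_trans _ _ (\sum_(0 <= i < N) hausdorff_gauge s (F i))%E).
    by rewrite -sumEFin big_mkord; apply: lee_sum.
  by apply: nneseries_lim_ge => k _ _; exact: hausdorff_gauge_ge0.
(* The geometric term makes all radii positive, also for empty sets and singletons, and uses the
   other half of [T]. *)
pose v i := di i `^ s1 + T / 2 / 2 ^+ i.+1.
have v0 i : 0 < v i.
  by rewrite ltr_wpDl ?powR_ge0 // divr_gt0 // exprn_gt0.
pose w i := v i `^ s1^-1.
have w0 i : 0 < w i by rewrite powR_gt0.
have wE i : w i `^ s1 = v i.
  by rewrite -powRrM mulVf ?gt_eqF // powRr1 // ltW.
exists c, w; split => //.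
  move=> x /cov[i _ Fx]; exists i.
  have Fc : F i (c i) by exact: (xgetPex _ (ex_intro _ x Fx)).
  apply: (@le_trans _ _ (di i)).
    rewrite /di; case: pselect => [?|[]]; last by exists x.
    have := le_diameter Fx Fc; move: (dF i).
    by case: (diameter (F i)).
  rewrite leNgt; apply/negP => wd.
  have : w i `^ s1 < di i `^ s1.
    by apply: gt0_ltr_powR; rewrite ?nnegrE ?di0 // ltW.
  by rewrite wE /v ltNge lerDl divr_ge0 ?exprn_ge0 // ltW.
move=> N; under eq_bigr do rewrite wE.
rewrite big_split /= [leRHS](_ : T = T / 2 + T / 2); last by lra.
by apply: lerD; [exact: dis|apply: geometric_budget; exact: ltW].
Qed.

(** The stages are iterated from [[0, 1]] at level [m0], and [x] is the common point. A ball
    containing [x] would meet every interval, so [state_mass] would bound its radius by lengths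
    tending to [0]. *)
Lemma exists_E_avoiding_balls (R : realType) (Psi omega : R -> R) (c w : nat -> R)
    (s : R) (m0 : nat)
  (Psi_gt0 : forall q : R, 0 < q -> 0 < Psi q)
  (omega_itv : forall q : R, 0 < q -> 0 < omega q < 1)
  (Psi_noninc : forall q r : R, 0 < q -> q <= r ->
    r ^+ 2 * Psi r <= q ^+ 2 * Psi q)
  (g_noninc : forall q r : nat, (0 < q)%N -> (q <= r)%N ->
    Psi r%:R * omega r%:R <= Psi q%:R * omega q%:R)
  (tail_small : forall m n, (m0 <= m)%N ->
    \sum_(m <= j < n) 4 ^+ j * Psi (2 ^+ j) <= 1 / 4096)
  (omega_small : forall q : R, 2 ^+ m0 <= q -> omega q <= 1 / 2)
  (omega_lb : forall q : R, 2 ^+ m0 <= q ->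
    omega q >= 45 / Psi q * Psi (1 / (2 * q * Psi q)))
  (s01 : 0 < s < 1)
  (unbounded : forall M N, exists2 n, (N <= n)%N &
    M < 4 ^+ n * (Psi (2 ^ n)%N%:R * omega (2 ^ n)%N%:R) `^ s)
  (w_gt0 : forall i, 0 < w i)
  (mass : forall N, \sum_(i < N) w i `^ s <= ((1 - 0) / 1024 / 128) `^ s) :
  exists2 x, E Psi omega x & forall i, w i < `|x - c i|.
Proof.
pose P (st : R * R * nat) := construction_state Psi omega c w s m0 st.1.1 st.1.2 st.2.
pose rel (st st' : R * R * nat) := [/\ st.1.1 <= st'.1.1, st'.1.2 <= st.1.2,
  (st.2 < st'.2)%N, st'.1.2 - st'.1.1 <= (2 ^+ st.2)^-1 &
  exists (p : int) (q : nat), (2 ^ st.2 <= q)%N /\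
    forall x, st'.1.1 <= x <= st'.1.2 -> `|x - p%:~R / q%:R| <= Psi q%:R].
have step st : exists st', P st -> P st' /\ rel st st'.
  have [Pst|nP] := pselect (P st); last by exists st.
  have [a' [b' [m' [Pst' [aa bb] mm len app]]]] := construction_step Psi_gt0 omega_itv
    Psi_noninc g_noninc tail_small omega_small omega_lb s01 unbounded w_gt0 Pst.
  by exists (a', b', m').
have [f Hf] := choice step.
have P0 : P (0, 1, m0).
  split => //=.
  - have : 1 <= 4 ^+ m0 :> R by rewrite exprn_ege1 // ler1n.
    by clear; lra.
  - by move=> x _ t /andP[h1 h2]; rewrite ltnNge h1 in h2.
  - move=> N; apply: le_trans (mass N); rewrite big_mkcond; apply: ler_sum => i _.
    by case: ifP => // _; exact: powR_ge0.
pose u k := iter k f (0, 1, m0).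
have Pu k : P (u k) by elim: k => //= k IH; have [] := Hf _ IH.
have ru k : rel (u k) (u k.+1) by have [] := Hf _ (Pu k).
pose a k := (u k).1.1; pose b k := (u k).1.2; pose m k := (u k).2.
have ab k : a k < b k by case: (Pu k).
have a_le k l : (k <= l)%N -> a k <= a l.
  move=> /subnKC <-; elim: (l - k)%N => [|n IH]; first by rewrite addn0.
  by rewrite addnS; apply: le_trans IH _; case: (ru (k + n)%N).
have b_le k l : (k <= l)%N -> b l <= b k.
  move=> /subnKC <-; elim: (l - k)%N => [|n IH]; first by rewrite addn0.
  by rewrite addnS; apply: le_trans _ IH; case: (ru (k + n)%N).
have a_le_b k l : a k <= b l.
  apply: le_trans (a_le _ _ (leq_maxl k l)) _.
  by apply: le_trans (ltW (ab _)) (b_le _ _ (leq_maxr k l)).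
have mk k : (k <= m k)%N.
  by elim: k => // k IH; apply: leq_ltn_trans IH _; case: (ru k).
have mm0 k : (m0 <= m k)%N by case: (Pu k).
pose x := sup (range a).
have xab k : a k <= x <= b k.
  apply/andP; split.
    apply: ub_le_sup; last by exists k.
    by exists (b 0%N) => _ [l _ <-].
  apply: ge_sup; first by exists (a 0%N), 0%N.
  by move=> _ [l _ <-].
exists x.
  split.
    move=> fin.
    pose S := [set pq : int * nat | (0 < pq.2)%N /\
             `|x - pq.1%:~R / pq.2%:R| <= Psi pq.2%:R].
    have [B HB] : exists B, forall pq, S pq -> (pq.2 < B)%N.
      have /finite_seqP[l lS] := fin.
      exists (\max_(pq <- l) pq.2).+1 => pq Spq; rewrite ltnS.
      by apply: (@leq_bigmax_seq _ _ _ (fun pq => pq.2)) => //; move: Spq; rewrite /S lS.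
    have [_ _ _ _ [p [q [qm pq]]]] := ru B.
    have Bq : (B < q)%N.
      by apply: leq_trans qm; apply: leq_ltn_trans (mk B) _; rewrite ltn_expl.
    have : S (p, q).
      by split => /=; [exact: leq_ltn_trans Bq|apply: pq; exact: (xab B.+1)].
    by move/HB; rewrite /= ltnNge ltnW.
  exists (2 ^ m0)%N => // q /= m0q p.
  have [_ _ _ avd _] := Pu q.
  apply: avd; first exact: xab.
  (* Stage [q] already handles denominator [q], as [q < 2^q <= 2^(m q)]. *)
  by rewrite m0q /=; apply: leq_trans (ltn_expl q (isT : (1 < 2)%N)) _; apply: leq_pexp2l.
move=> i; rewrite ltNge; apply/negP => xi.
have [s0 _] := andP s01.
have wD k : w i <= b k - a k.
  have lam0 : 0 < b k - a k by rewrite subr_gt0.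
  have [_ _ _ _ massk] := Pu k.
  have := massk i.+1; rewrite big_mkcond big_ord_recr /=.
  have /andP[x1 x2] := xab k.
  have -> : (a k - w i <= c i <= b k + w i).
    by move: xi; rewrite ler_norml => /andP[h1 h2]; apply/andP; split;
      move: x1 x2 h1 h2; clear; lra.
  move=> h; rewrite leNgt; apply/negP => lt.
  have D0 : 0 < (b k - a k) / 1024 / 128 by rewrite !divr_gt0 ?ltr0n.
  have Dl : (b k - a k) / 1024 / 128 < w i by move: lt lam0; clear; lra.
  have : ((b k - a k) / 1024 / 128) `^ s < w i `^ s.
    by apply: gt0_ltr_powR; rewrite ?nnegrE ?(ltW D0) ?(ltW (w_gt0 i)) ?Dl.
  rewrite ltNge => /negP[]; apply: le_trans h.
  by rewrite lerDr sumr_ge0 // => j _; case: ifP => // _; exact: powR_ge0.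
have [k Hk] := exists_large_scale (2 / w i).
have h1 : 2 / w i <= 2 ^+ m k by apply: Hk; exact: mk.
have : w i <= (2 ^+ m k)^-1 by apply: le_trans (wD k.+1) _; case: (ru k).
have Q0 : (0 : R) < 2 ^+ m k by rewrite exprn_gt0.
rewrite -(ler_pM2l Q0) mulfV ?gt_eqF //; move: h1; rewrite ler_pdivrMr //.
by clear; lra.
Qed.

Theorem theorem1p6 (R : realType) (Psi omega : R -> R)
  (Psi_gt0 : forall q : R, 0 < q -> 0 < Psi q)
  (omega_itv : forall q : R, 0 < q -> 0 < omega q < 1)
  (Psi_noninc : forall q r : R, 0 < q -> q <= r ->
    r ^+ 2 * Psi r <= q ^+ 2 * Psi q)
  (Psi_omega_noninc : forall q r : R, 0 < q -> q <= r ->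
    r ^+ 2 * Psi r * omega r <= q ^+ 2 * Psi q * omega q)
  (Psi_summable : (\sum_(1 <= q <oo) (q%:R * Psi q%:R)%:E < +oo)%E)
  (omega_lim0 : omega q @[q --> +oo] --> (0 : R))
  (omega_lb : \forall q \near +oo,
    omega q >= 45 / Psi q * Psi (1 / (2 * q * Psi q))) :
  hausdorff_dim (E Psi omega) =
  ereal_inf [set s%:E | s in [set s : R | 0 <= s /\
    (\sum_(1 <= q <oo) (q%:R * (Psi q%:R * omega q%:R) `^ s)%:E < +oo)%E]].
Proof.
pose g (q : nat) : R := Psi q%:R * omega q%:R.
have g_gt0 q : (0 < q)%N -> 0 < g q.
  move=> q0; have qR : (0 : R) < q%:R by rewrite ltr0n.
  by rewrite mulr_gt0 ?Psi_gt0 //; have /andP[] := omega_itv _ qR.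
have g_noninc q r : (0 < q)%N -> (q <= r)%N -> g r <= g q.
  move=> q0 qr; have qR : (0 : R) < q%:R by rewrite ltr0n.
  have qrR : q%:R <= r%:R :> R by rewrite ler_nat.
  have h : r%:R ^+ 2 * g r <= q%:R ^+ 2 * g q.
    by rewrite /g !mulrA; exact: Psi_omega_noninc.
  rewrite -(@ler_pM2l _ (q%:R ^+ 2)) ?exprn_gt0 //; apply: le_trans h.
  rewrite ler_wpM2r ?(ltW (g_gt0 _ _)) ?(leq_trans q0) //.
  by rewrite ler_sqr ?nnegrE ?ler0n.
apply/le_anti/andP; split.
  apply: ereal_inf_le_tmp => _ [s [s0 fin] <-]; exists s => //; split => //.
  exact: hausdorff_measure_E_eq0.
set inf := ereal_inf _.
apply: le_ereal_inf_tmp => _ [s [s0 Hs] <-]; rewrite leNgt; apply/negP => lts.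
(* At exponent [1] the series is dominated by that of [q * Psi q]; this keeps [s1] below [1]. *)
have in1 : (inf <= 1%:E)%E.
  apply: ereal_inf_lbound; exists 1 => //; split => //.
  apply: le_lt_trans Psi_summable; apply: lee_nneseries => [q _ _|[_|q' _]].
  - by rewrite lee_fin mulr_ge0 ?powR_ge0.
  - by rewrite !mul0r.
  have q0 : (0 < q'.+1)%N by [].
  move: q'.+1 q0 => q q0.
  have qR : (0 : R) < q%:R by rewrite ltr0n.
  rewrite lee_fin powRr1 ?(ltW (g_gt0 _ _)) // ler_wpM2l // ler_piMr ?(ltW (Psi_gt0 _ _)) //.
  by have /andP[_ /ltW] := omega_itv _ qR.
have inf_fin : inf \is a fin_num.
  by rewrite fin_numE; case: (inf) in1 lts.
pose s3 := fine inf.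
have s3E : inf = s3%:E by rewrite /s3 fineK.
have ss3 : s < s3 by rewrite -lte_fin -s3E.
have s31 : s3 <= 1 by rewrite -lee_fin -s3E.
(* Two exponents with [s < s1 < s2 < inf]: divergence at [s2] gives unboundedness at [s1], and
   [s < s1] turns [s]-null covers into balls of small [s1]-mass, with [s1 > 0] even when [s = 0]. *)
pose s1 := (2 * s + s3) / 3; pose s2 := (s + 2 * s3) / 3.
have s12 : 0 < s1 < s2 by rewrite /s1 /s2; apply/andP; split; lra.
have s11 : 0 < s1 < 1 by rewrite /s1; apply/andP; split; lra.
have ss1 : 0 <= s <= s1 by rewrite /s1; apply/andP; split; lra.
have [s10 _] := andP s11.
have div : ~ (\sum_(1 <= q <oo) (q%:R * g q `^ s2)%:E < +oo)%E.
  move=> fin; have : (inf <= s2%:E)%E.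
    apply: ereal_inf_lbound; exists s2 => //; split => //.
    by rewrite /s2; lra.
  by rewrite s3E lee_fin /s2; lra.
have half0 : (0 : R) < 1 / 2 by [].
have e0 : (0 : R) < 1 / 4096 by rewrite divr_gt0 ?ltr0n.
have [m1 Hm1] := dyadic_sum_tail Psi_gt0 Psi_noninc Psi_summable e0.
have om_near : \forall q \near +oo, omega q < 1 / 2.
  exact: (cvgr_lt _ omega_lim0 _ half0).
have [A [_ HA]] := filterI om_near omega_lb.
have [m2 Hm2] := exists_large_scale (A + 1).
pose m0 := maxn m1 m2.
have large q : 2 ^+ m0 <= q -> A < q.
  move=> h; apply: (@lt_le_trans _ _ (A + 1)); first by rewrite ltrDl.
  by apply: le_trans (Hm2 _ _) h; exact: leq_maxr.
(* The total mass is the allowance of the initial interval [[0, 1]]. *)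
have T0 : 0 < ((1 - 0) / 1024 / 128) `^ s1 :> R.
  by apply: powR_gt0; rewrite subr0 !divr_gt0 ?ltr0n ?ltr01.
have [c [w [w0 cov mass]]] := hausdorff_null_balls ss1 s10 T0 Hs.
have [x Ex far] := @exists_E_avoiding_balls R Psi omega c w s1 m0 Psi_gt0 omega_itv
  Psi_noninc g_noninc
  (fun m n h => Hm1 m n (leq_trans (leq_maxl _ _) h))
  (fun q h => ltW (HA q (large q h)).1) (fun q h => (HA q (large q h)).2)
  s11 (fun M N => dyadic_unbounded M N g_gt0 g_noninc s12 div) w0 mass.
by have [i] := cov x Ex; rewrite leNgt far.
Qed.
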